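(* Let $\Phi$ be a strictly pure $\mathbf{t}$-module over $L$ of dimension $d$ with no nilpotence, and let $n=\deg_\tau\Phi\geq 2$. Then: (a) The $\mathbb{F}_q[t]$-module $\operatorname{Ext}^1_{\tau}(\Phi,C)$ has a natural structure of a $\mathbf{t}$-module of dimension $n\cdot d$, and it sits in an exact sequence of $\mathbf{t}$-modules $$0\longrightarrow \Phi^{\vee}\longrightarrow \operatorname{Ext}^1_{\tau}(\Phi,C)\longrightarrow \mathbb{G}_a^{d}\longrightarrow 0.$$ (b) The $\mathbb{F}_q[t]$-module $\operatorname{Ext}^1_{\tau}(\Phi^{\vee},C)$ also has a natural structure of a $\mathbf{t}$-module of dimension $d\cdot n$, and it sits in an exact sequence of $\mathbf{t}$-modules $$0\longrightarrow \Phi\longrightarrow \operatorname{Ext}^1_{\tau}(\Phi^{\vee},C)\longrightarrow \mathbb{G}_a^{(n-1)d}\longrightarrow 0.$$ Moreover, there is a biduality $(\Phi^{\vee})^{\vee}\cong\Phi$ (isomorphism of $\mathbf{t}$-modules). (c) Any morphism $\beta:\Phi\to\Psi$ of strictly pure $\mathbf{t}$-modules with no nilpotence, both of $\tau$-degree $\geq 2$, induces a morphism of dual $\mathbf{t}$-modules $\beta^{\vee}:\Psi^{\vee}\to\Phi^{\vee}$.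
   Context: Let $q$ be a prime power, $A=\mathbb{F}_q[t]$, and let $L$ be a field with an $\mathbb{F}_q$-algebra homomorphism $\iota:A\to L$; put $\theta=\iota(t)$. Let $L\{\tau\}$ be the twisted polynomial ring with $\tau c=c^q\tau$ for $c\in L$. A $\mathbf{t}$-module of dimension $d$ over $L$ is an $\mathbb{F}_q$-algebra homomorphism $\Phi:A\to \mathrm{Mat}_d(L\{\tau\})$ with $\Phi_t:=\Phi(t)=(\theta I_d+N_\Phi)+M_1\tau+\dots+M_r\tau^r$, $N_\Phi$ nilpotent, $M_i\in\mathrm{Mat}_d(L)$; it is determined by $\Phi_t$, and $\deg_\tau\Phi:=\deg_\tau\Phi_t$. It has no nilpotence if $N_\Phi=0$, and is strictly pure if the leading coefficient $M_r$ ($r=\deg_\tau\Phi$) is invertible. A morphism $f:\Phi\to\Psi$ from a $\mathbf{t}$-module of dimension $d$ to one of dimension $e$ is a matrix $f\in\mathrm{Mat}_{e\times d}(L\{\tau\})$ with $f\Phi_t=\Psi_t f$. $\mathbb{G}_a^m$ denotes the $\mathbf{t}$-module with $t\mapsto\theta I_m$. The Carlitz module $C$ is the $1$-dimensional $\mathbf{t}$-module with $C_t=\theta+\tau$. A $\mathbf{t}$-module of dimension $m$ endows $L^m$ with an $\mathbb{F}_q[t]$-module structure; an $\mathbb{F}_q[t]$-module is said to have a (natural) $\mathbf{t}$-module structure of dimension $m$ if it is identified $\mathbb{F}_q$-linearly with $L^m$ so that the action of $t$ is given by a $\mathbf{t}$-module. For $\mathbf{t}$-modules $\Phi$ (dimension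 $d$) and $\Psi$ (dimension $e$): the space of biderivations $\mathrm{Der}(\Phi,\Psi)$ is the set of $\mathbb{F}_q$-linear $\delta:A\to\mathrm{Mat}_{e\times d}(L\{\tau\})$ with $\delta(ab)=\Psi_a\delta(b)+\delta(a)\Phi_b$; it is identified with $\mathrm{Mat}_{e\times d}(L\{\tau\})$ via $\delta\mapsto\delta(t)$. The inner biderivations $\mathrm{Der}_{in}(\Phi,\Psi)$ are the $\delta^{(U)}$, $U\in \mathrm{Mat}_{e\times d}(L\{\tau\})$, with $\delta^{(U)}(a)=U\Phi_a-\Psi_aU$. Then $\operatorname{Ext}^1_\tau(\Phi,\Psi):=\mathrm{Der}(\Phi,\Psi)/\mathrm{Der}_{in}(\Phi,\Psi)$ (isomorphic to the Baer group of extensions of $\Phi$ by $\Psi$ in the category of $\mathbf{t}$-modules), an $\mathbb{F}_q[t]$-module via $a*\delta=\Psi_a\delta$. Let $\mathrm{Der}_0$, $\mathrm{Der}_{0,in}$ be the subspaces of those biderivations (resp. inner biderivations) $\delta$ for which $\delta(t)$ has zero constant term in $\tau$, and $\operatorname{Ext}^1_{0,\tau}(\Phi,\Psi):=\mathrm{Der}_0(\Phi,\Psi)/\mathrm{Der}_{0,in}(\Phi,\Psi)$. The dual of $\Phi$ is $\Phi^{\vee}:=\operatorname{Ext}^1_{0,\tau}(\Phi,C)$. *)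

(* Defs.v *)
From HB Require Import structures.
From mathcomp Require Import all_boot all_order all_algebra all_field.

Set Implicit Arguments.
Unset Strict Implicit.
Unset Printing Implicit Defensive.

Import GRing.Theory.
Local Open Scope ring_scope.

(* The skew polynomial ring R{tau; s}: the additive group of {poly R}, with   *)
(* tau * c = s c * tau.  The coefficients stand to the left of tau.           *)
Record skew_poly (R : nzRingType) (s : {rmorphism R -> R}) : predArgType :=
  SkewPoly { skew_val : {poly R} }.

Section SkewPoly.
Variables (R : nzRingType) (s : {rmorphism R -> R}).
Local Notation S := (skew_poly s).

HB.instance Definition _ := [isNew for @skew_val R s].
HB.instance Definition _ := [Choice of S by <:].

Definition skew_coef (p : S) (i : nat) : R := (skew_val p)`_i.
Definition skew_size (p : S) : nat := size (skew_val p).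

Definition skew_zero : S := SkewPoly s 0.
Definition skew_opp (p : S) : S := SkewPoly s (- skew_val p).
Definition skew_add (p q : S) : S := SkewPoly s (skew_val p + skew_val q).

Fact skew_addA : associative skew_add.
Proof. by move=> p q r; rewrite /skew_add addrA. Qed.
Fact skew_addC : commutative skew_add.
Proof. by move=> p q; rewrite /skew_add addrC. Qed.
Fact skew_add0 : left_id skew_zero skew_add.
Proof. by case=> p; rewrite /skew_add add0r. Qed.
Fact skew_addN : left_inverse skew_zero skew_opp skew_add.
Proof. by move=> p; rewrite /skew_add addNr. Qed.

HB.instance Definition _ := GRing.isZmodule.Build S
  skew_addA skew_addC skew_add0 skew_addN.

(* c * tau ^ i                                                                *)
Definition skew_mon (c : R) (i : nat) : S := SkewPoly s (c *: 'X^i).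

Definition skew_mul (p q : S) : S :=
  SkewPoly s (\poly_(k < (skew_size p + skew_size q).-1)
     \sum_(i < k.+1) skew_coef p i * iter i s (skew_coef q (k - i))).

Lemma skew_iterD i a b : iter i s (a + b) = iter i s a + iter i s b.
Proof. by elim: i => //= i ->; rewrite rmorphD. Qed.

Lemma skew_iter0 i : iter i s 0 = 0.
Proof. by elim: i => //= i ->; rewrite rmorph0. Qed.

Lemma skew_iter1 i : iter i s 1 = 1.
Proof. by elim: i => //= i ->; rewrite rmorph1. Qed.

Lemma skew_iterM i a b : iter i s (a * b) = iter i s a * iter i s b.
Proof. by elim: i => //= i ->; rewrite rmorphM. Qed.

Lemma skew_iter_sum i (I : Type) (r : seq I) (P : pred I) (f : I -> R) :
  iter i s (\sum_(j <- r | P j) f j) = \sum_(j <- r | P j) iter i s (f j).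
Proof.
by elim/big_rec2: _ => [|j y x _ <-]; rewrite ?skew_iter0 ?skew_iterD.
Qed.

Lemma skew_polyP (p q : S) : (forall i, skew_coef p i = skew_coef q i) -> p = q.
Proof. by move=> eq_pq; apply/val_inj/polyP. Qed.

Lemma skew_coefD p q i : skew_coef (p + q) i = skew_coef p i + skew_coef q i.
Proof. exact: coefD. Qed.

Lemma skew_coef_mon c i k : skew_coef (skew_mon c i) k = if k == i then c else 0.
Proof. by rewrite /skew_coef coefZ coefXn; case: eqP; rewrite ?mulr1 ?mulr0. Qed.

Lemma skew_coef_mul p q k :
  skew_coef (skew_mul p q) k =
  \sum_(i < k.+1) skew_coef p i * iter i s (skew_coef q (k - i)).
Proof.
rewrite {1}/skew_coef coef_poly ltn_predRL; case: leqP => // le_pq_k1.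
rewrite big1 // => j _; have [lq_p_j|lt_j_p] := leqP (skew_size p) j.
  by rewrite /skew_coef nth_default ?mul0r.
rewrite [skew_coef q _]nth_default ?skew_iter0 ?mulr0 // leq_subRL -ltnS //.
by rewrite (leq_trans _ le_pq_k1) // ltn_add2r.
Qed.

Fact skew_mulA : associative skew_mul.
Proof.
move=> p q r; apply: skew_polyP => k; rewrite !skew_coef_mul.
pose c j i := skew_coef p j * iter j s (skew_coef q (i - j)) *
  iter i s (skew_coef r (k - i)).
transitivity (\sum_(j < k.+1) \sum_(i < k.+1 | (j <= i)%N) c j i).
  apply: eq_bigr => j _; rewrite skew_coef_mul skew_iter_sum big_distrr /=.
  have le_jk : (j <= k)%N by rewrite -ltnS.
  rewrite -(big_mkord (fun i => j <= i)%N (c j)).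
  rewrite -(@big_nat_widenl _ _ _ j 0 k.+1 xpredT) //.
  rewrite -[X in index_iota X]add0n big_addn big_mkord subSn //.
  apply: eq_bigr => i _; rewrite /c addnK skew_iterM mulrA -iterD addnC.
  by rewrite subnDA subnAC.
rewrite (exchange_big_dep predT) //=; apply: eq_bigr => i _.
rewrite skew_coef_mul big_distrl /= -(big_mkord (fun j => j <= i)%N (c^~ i)).
by rewrite -(@big_nat_widen _ _ _ 0 i.+1 k.+1 xpredT) ?big_mkord // ltn_ord.
Qed.

Fact skew_mul1l : left_id (skew_mon 1 0) skew_mul.
Proof.
move=> p; apply: skew_polyP => k; rewrite skew_coef_mul big_ord_recl subn0.
rewrite big1 => [|i _]; first by rewrite skew_coef_mon addr0 mul1r.
by rewrite skew_coef_mon mul0r.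
Qed.

Fact skew_mul1r : right_id (skew_mon 1 0) skew_mul.
Proof.
move=> p; apply: skew_polyP => k; rewrite skew_coef_mul big_ord_recr /= subnn.
rewrite big1 => [|i _]; first by rewrite skew_coef_mon add0r skew_iter1 mulr1.
by rewrite skew_coef_mon subn_eq0 leqNgt ltn_ord skew_iter0 mulr0.
Qed.

Fact skew_mulDl : left_distributive skew_mul +%R.
Proof.
move=> p q r; apply: skew_polyP => k; rewrite skew_coefD !skew_coef_mul -big_split.
by apply: eq_bigr => j _; rewrite skew_coefD mulrDl.
Qed.

Fact skew_mulDr : right_distributive skew_mul +%R.
Proof.
move=> p q r; apply: skew_polyP => k; rewrite skew_coefD !skew_coef_mul -big_split.
by apply: eq_bigr => j _; rewrite skew_coefD skew_iterD mulrDr.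
Qed.

Fact skew_1neq0 : skew_mon 1 0 != 0.
Proof.
apply/eqP => /(congr1 (skew_coef^~ 0%N)); rewrite skew_coef_mon.
by rewrite /skew_coef coef0 => /eqP; rewrite oner_eq0.
Qed.

HB.instance Definition _ := GRing.Zmodule_isNzRing.Build S
  skew_mulA skew_mul1l skew_mul1r skew_mulDl skew_mulDr skew_1neq0.

Lemma skew_coefM (p q : S) k :
  skew_coef (p * q) k =
  \sum_(i < k.+1) skew_coef p i * iter i s (skew_coef q (k - i)).
Proof. exact: skew_coef_mul. Qed.

End SkewPoly.

Section Twisted.
Variables (F : finFieldType) (L : fieldType).
Implicit Type iota : {rmorphism {poly F} -> L}.

(* iota makes L an F-algebra, so that x |-> x ^+ #|F| is additive on L.       *)
Definition frob iota : L -> L := fun x => x ^+ #|F|.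

Lemma card_pchar_nat iota : [pchar L].-nat #|F|.
Proof.
have [p p_pr pcharFp] := finPcharP F.
have pcharLp : p \in [pchar L].
  by apply: (rmorph_pchar iota); rewrite pchar_poly.
rewrite (eq_pnat _ (pcharf_eq pcharLp)) (card_pprimeChar pcharFp).
by rewrite pnatX pnat_id.
Qed.

Fact frob_is_nmod_morphism iota : nmod_morphism (frob iota).
Proof.
split=> [|x y]; rewrite /frob; last exact: exprDn_pchar (card_pchar_nat iota).
by rewrite expr0n gtn_eqF // (ltn_trans _ (finNzRing_gt1 F)).
Qed.

Fact frob_is_monoid_morphism iota : monoid_morphism (frob iota).
Proof. by split=> [|x y]; rewrite /frob ?expr1n ?exprMn. Qed.

HB.instance Definition _ iota :=
  GRing.isNmodMorphism.Build L L (frob iota) (frob_is_nmod_morphism iota).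
HB.instance Definition _ iota :=
  GRing.isMonoidMorphism.Build L L (frob iota) (frob_is_monoid_morphism iota).

(* L{tau}                                                                     *)
Definition twisted iota : nzRingType := skew_poly (frob iota).

Variable iota : {rmorphism {poly F} -> L}.
Local Notation S := (twisted iota).

Definition tcst (c : L) : S := skew_mon (frob iota) c 0.
Definition tau : S := skew_mon (frob iota) 1 1.

Lemma tcstD : {morph tcst : x y / x + y}.
Proof.
by move=> x y; apply: skew_polyP => k; rewrite skew_coefD !skew_coef_mon;
  case: eqP; rewrite ?addr0.
Qed.

Lemma tcst0 : tcst 0 = 0.
Proof.
by apply: skew_polyP => k; rewrite skew_coef_mon if_same /skew_coef coef0.
Qed.

Lemma coef_tcstM c (p : S) k : skew_coef (tcst c * p) k = c * skew_coef p k.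
Proof.
rewrite skew_coefM big_ord_recl subn0 big1 ?addr0 => [|i _].
  by rewrite skew_coef_mon.
by rewrite skew_coef_mon mul0r.
Qed.

Lemma coef_Mtcst c (p : S) k :
  skew_coef (p * tcst c) k = skew_coef p k * iter k (frob iota) c.
Proof.
rewrite skew_coefM big_ord_recr /= subnn big1 ?add0r => [|i _].
  by rewrite skew_coef_mon.
by rewrite skew_coef_mon subn_eq0 leqNgt ltn_ord skew_iter0 mulr0.
Qed.

Lemma tcstM : {morph tcst : x y / x * y}.
Proof.
move=> x y; apply: skew_polyP => k.
by rewrite coef_tcstM !skew_coef_mon; case: eqP; rewrite ?mulr0.
Qed.

Lemma tcst_central (c : F) (p : S) :
  p * tcst (iota c%:P) = tcst (iota c%:P) * p.
Proof.
apply: skew_polyP => k; rewrite coef_tcstM coef_Mtcst mulrC; congr (_ * _).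
elim: k => //= k ->; rewrite /frob -rmorphXn /= -[RHS]/(iota c%:P).
by rewrite -polyC_exp expf_card.
Qed.

Lemma tcst_scale_mul m n r (c : F) (A : 'M[S]_(m, n)) (B : 'M[S]_(n, r)) :
  A *m (tcst (iota c%:P) *: B) = tcst (iota c%:P) *: (A *m B).
Proof.
apply/matrixP=> i j; rewrite !mxE mulr_sumr; apply: eq_bigr => k _.
by rewrite !mxE mulrA tcst_central mulrA.
Qed.

Definition mx_coef m n (M : 'M[S]_(m, n)) (i : nat) : 'M[L]_(m, n) :=
  map_mx (fun p : S => skew_coef p i) M.

Definition mx_deg m n (M : 'M[S]_(m, n)) : nat :=
  \max_(i < m) \max_(j < n) (skew_size (M i j)).-1.

(* The additive polynomial map attached to a twisted polynomial.              *)
Definition tw_eval (p : S) (x : L) : L :=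
  \sum_(i < skew_size p) skew_coef p i * x ^+ (#|F| ^ i).

Definition mx_eval m n (M : 'M[S]_(m, n)) (x : 'cV[L]_n) : 'cV[L]_m :=
  \col_i \sum_j tw_eval (M i j) (x j 0).

Definition theta : L := iota 'X.

Record tmodule (d : nat) := TModule {
  tm_map :> {rmorphism {poly F} -> 'M[S]_d};
  tm_alg : forall c : F, tm_map c%:P = (tcst (iota c%:P))%:M;
  tm_nilp : exists k, (mx_coef (tm_map 'X) 0 - theta%:M) ^+ k = 0
}.

Definition tm_deg d (Phi : tmodule d) : nat := mx_deg (Phi 'X).

Definition no_nilpotence d (Phi : tmodule d) : Prop :=
  mx_coef (Phi 'X) 0 = theta%:M.

Definition strictly_pure d (Phi : tmodule d) : Prop :=
  mx_coef (Phi 'X) (tm_deg Phi) \in unitmx.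

(* A t-module is determined by the image of t.                                *)
Section Build.
Variables (d : nat) (T : 'M[S]_d).

Definition tm_hom (a : {poly F}) : 'M[S]_d :=
  \sum_(i < size a) tcst (iota (a`_i)%:P) *: T ^+ i.

Lemma tm_homE n (a : {poly F}) : (size a <= n)%N ->
  tm_hom a = \sum_(i < n) tcst (iota (a`_i)%:P) *: T ^+ i.
Proof.
move=> le_an; rewrite /tm_hom (big_ord_widen _ (fun i => tcst (iota (a`_i)%:P) *: T ^+ i) le_an).
rewrite big_mkcond /=; apply: eq_bigr => i _; case: ltnP => // le_ai.
by rewrite nth_default // rmorph0 tcst0 scale0r.
Qed.

Fact tm_hom_is_nmod_morphism : nmod_morphism tm_hom.
Proof.
split=> [|a b]; first by rewrite /tm_hom size_poly0 big_ord0.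
pose n := maxn (size a) (size b).
rewrite (@tm_homE n) ?size_polyD // (@tm_homE n a) ?leq_maxl //.
rewrite (@tm_homE n b) ?leq_maxr // -big_split; apply: eq_bigr => i _ /=.
by rewrite coefD !rmorphD /= tcstD scalerDl.
Qed.
HB.instance Definition _ :=
  GRing.isNmodMorphism.Build {poly F} 'M[S]_d tm_hom tm_hom_is_nmod_morphism.

Lemma tm_homC c : tm_hom c%:P = (tcst (iota c%:P))%:M.
Proof.
by rewrite (@tm_homE 1) ?size_polyC_leq1 // big_ord1 coefC expr0 scalemx1.
Qed.

Lemma tm_homXM a : tm_hom (a * 'X) = tm_hom a * T.
Proof.
rewrite (@tm_homE (size a).+1); last first.
  by have [->|] := eqVneq a 0; rewrite ?mul0r ?size_poly0 // => /size_mulX->.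
rewrite big_ord_recl coefMX rmorph0 tcst0 scale0r add0r mulr_suml.
by apply: eq_bigr => i _; rewrite coefMX /= exprSr; exact: scalemxAl.
Qed.

Lemma tm_homZ c a : tm_hom (c *: a) = tcst (iota c%:P) *: tm_hom a.
Proof.
rewrite (@tm_homE (size a)) ?size_scale_leq // scaler_sumr.
by apply: eq_bigr => i _; rewrite coefZ polyCM rmorphM /= tcstM scalerA.
Qed.

Fact tm_hom_is_monoid_morphism : monoid_morphism tm_hom.
Proof.
split=> [|a b]; first by rewrite -polyC1 tm_homC rmorph1.
elim/poly_ind: b => [|b c IH]; first by rewrite !(mulr0, raddf0).
rewrite mulrDr !raddfD /= mulrA !tm_homXM IH mulrDr mulrA; congr (_ + _).
rewrite mulrC mul_polyC tm_homZ tm_homC -[tcst _ in RHS]mulr1 -scale_scalar_mx.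
by rewrite [RHS]tcst_scale_mul [in RHS]mulmx1.
Qed.
HB.instance Definition _ :=
  GRing.isMonoidMorphism.Build {poly F} 'M[S]_d tm_hom tm_hom_is_monoid_morphism.

Lemma tm_homX : tm_hom 'X = T.
Proof. by rewrite -['X]mul1r tm_homXM rmorph1 mul1r. Qed.

Fact tm_hom_nilp :
  (exists k, (mx_coef T 0 - theta%:M) ^+ k = 0) ->
  exists k, (mx_coef (tm_hom 'X) 0 - theta%:M) ^+ k = 0.
Proof. by rewrite tm_homX. Qed.

Definition tmodule_of_mx (nilT : exists k, (mx_coef T 0 - theta%:M) ^+ k = 0) :
  tmodule d :=
  TModule tm_homC (tm_hom_nilp nilT).

End Build.
End Twisted.

Section Examples.
Variables (F : finFieldType) (L : fieldType) (iota : {rmorphism {poly F} -> L}).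

Fact Ga_nilp m :
  exists k, (mx_coef ((tcst iota (theta iota))%:M : 'M_m) 0
             - (theta iota)%:M) ^+ k = 0.
Proof.
exists 1; rewrite expr1; apply/matrixP=> i j; rewrite !mxE.
by case: eqP => _; rewrite ?mulr1n ?mulr0n /skew_coef ?coef0 ?subrr //
  -/(skew_coef _ _) skew_coef_mon subrr.
Qed.
Definition Ga m : tmodule iota m := tmodule_of_mx (Ga_nilp m).

Fact Carlitz_nilp :
  exists k, (mx_coef ((tcst iota (theta iota) + tau iota)%:M : 'M_1) 0
             - (theta iota)%:M) ^+ k = 0.
Proof.
exists 1; rewrite expr1; apply/matrixP=> i j; rewrite !mxE !ord1 eqxx !mulr1n.
by rewrite skew_coefD !skew_coef_mon addr0 subrr.
Qed.
Definition Carlitz : tmodule iota 1 := tmodule_of_mx Carlitz_nilp.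

End Examples.

Section BaseChange.
Variables (F : finFieldType) (L : fieldType) (iota : {rmorphism {poly F} -> L}).
Variables (K : fieldType) (j : {rmorphism L -> K}).

Definition bc_iota : {rmorphism {poly F} -> K} := j \o iota.

Definition bc_tw (p : twisted iota) : twisted bc_iota :=
  SkewPoly (frob bc_iota) (map_poly j (skew_val p)).

Definition bc_mx m n (M : 'M[twisted iota]_(m, n)) : 'M[twisted bc_iota]_(m, n) :=
  map_mx bc_tw M.

Fact bc_nilp d (Phi : tmodule iota d) :
  exists k, (mx_coef (bc_mx (Phi 'X)) 0 - (theta bc_iota)%:M) ^+ k = 0.
Proof.
have [k nilk] := tm_nilp Phi; exists k.
have -> : mx_coef (bc_mx (Phi 'X)) 0 - (theta bc_iota)%:M
        = map_mx j (mx_coef (Phi 'X) 0 - (theta iota)%:M).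
  rewrite map_mxB map_scalar_mx; congr (_ - _).
  by apply/matrixP=> a b; rewrite !mxE /skew_coef coef_map.
by rewrite -rmorphXn /= nilk map_mx0.
Qed.
(* The t-module over K given by the same matrix.                             *)
Definition bc_tm d (Phi : tmodule iota d) : tmodule bc_iota d :=
  tmodule_of_mx (bc_nilp Phi).

End BaseChange.

Section Morphisms.
Variables (F : finFieldType) (L : fieldType) (iota : {rmorphism {poly F} -> L}).
Local Notation S := (twisted iota).

Definition tm_morphism d e (Phi : tmodule iota d) (Psi : tmodule iota e)
    (f : 'M[S]_(e, d)) : Prop :=
  f *m Phi 'X = Psi 'X *m f.

Definition tm_iso d (Phi Psi : tmodule iota d) (f : 'M[S]_d) : Prop :=
  tm_morphism Phi Psi f /\
  exists g, [/\ tm_morphism Psi Phi g, f *m g = 1%:M & g *m f = 1%:M].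

(* 0 -> Phi1 -f-> Phi2 -g-> Phi3 -> 0 is exact on K-points for every field    *)
(* extension K / L, that is, exact as a sequence of group schemes: taking     *)
(* K = L(x) excludes purely inseparable maps such as tau.  On L-points alone  *)
(* the condition would be too weak (tau is bijective on a finite L).          *)
Definition tm_short_exact d1 d2 d3 (Phi1 : tmodule iota d1)
    (Phi2 : tmodule iota d2) (Phi3 : tmodule iota d3)
    (f : 'M[S]_(d2, d1)) (g : 'M[S]_(d3, d2)) : Prop :=
  [/\ tm_morphism Phi1 Phi2 f, tm_morphism Phi2 Phi3 g
    & forall (K : fieldType) (j : {rmorphism L -> K}),
      [/\ forall x, mx_eval (bc_mx j f) x = 0 -> x = 0,
          forall y, mx_eval (bc_mx j g) y = 0 <->
                    exists x, y = mx_eval (bc_mx j f) x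
        & forall z, exists y, z = mx_eval (bc_mx j g) y]].

End Morphisms.

Section Biderivations.
Variables (F : finFieldType) (L : fieldType) (iota : {rmorphism {poly F} -> L}).
Local Notation S := (twisted iota).
Variables (d e : nat) (Phi : tmodule iota d) (Psi : tmodule iota e).
Implicit Type delta : {poly F} -> 'M[S]_(e, d).

Definition Der delta : Prop :=
  (forall (c : F) a b,
     delta (c *: a + b) = tcst iota (iota c%:P) *: delta a + delta b) /\
  (forall a b, delta (a * b) = Psi a *m delta b + delta a *m Phi b).

Definition Der_in delta : Prop :=
  exists U : 'M[S]_(e, d), forall a, delta a = U *m Phi a - Psi a *m U.

Definition const0 delta : Prop := mx_coef (delta 'X) 0 = 0.

Definition Der0 delta : Prop := Der delta /\ const0 delta.
Definition Der0_in delta : Prop := Der_in delta /\ const0 delta.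

(* The inverse of the identification delta |-> delta 'X of Der with matrices: *)
(* see biderX, bider_Der and Der_bider.                                       *)
Definition bider (D : 'M[S]_(e, d)) (a : {poly F}) : 'M[S]_(e, d) :=
  \sum_(k < size a) tcst iota (iota (a`_k)%:P) *:
     \sum_(i < k) Psi 'X^i *m D *m Phi 'X^(k.-1 - i).

Lemma biderE D n (a : {poly F}) : (size a <= n)%N ->
  bider D a = \sum_(k < n) tcst iota (iota (a`_k)%:P) *:
     \sum_(i < k) Psi 'X^i *m D *m Phi 'X^(k.-1 - i).
Proof.
move=> le_an; rewrite /bider (big_ord_widen _ (fun k => tcst iota (iota (a`_k)%:P) *:
     \sum_(i < k) Psi 'X^i *m D *m Phi 'X^(k.-1 - i)) le_an).
rewrite big_mkcond /=; apply: eq_bigr => i _; case: ltnP => // le_ai.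
by rewrite nth_default // rmorph0 tcst0 scale0r.
Qed.

Lemma bider_lin D (c : F) (a b : {poly F}) :
  bider D (c *: a + b) = tcst iota (iota c%:P) *: bider D a + bider D b.
Proof.
pose n := maxn (size a) (size b).
have le_n : (size (c *: a + b)%R <= n)%N.
  rewrite (leq_trans (size_polyD _ _)) // geq_max leq_maxr andbT.
  by rewrite (leq_trans (size_scale_leq _ _)) ?leq_maxl.
rewrite (biderE _ le_n).
rewrite (@biderE _ n a) ?leq_maxl // (@biderE _ n b) ?leq_maxr //.
rewrite scaler_sumr -big_split; apply: eq_bigr => i _ /=.
by rewrite coefD coefZ polyCD polyCM rmorphD rmorphM /= tcstD tcstM scalerDl scalerA.
Qed.

Lemma bider0 D : bider D 0 = 0.
Proof. by rewrite /bider size_poly0 big_ord0. Qed.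

Lemma biderC D c : bider D c%:P = 0.
Proof.
by rewrite (@biderE _ 1) ?size_polyC_leq1 // big_ord1 big_ord0 scaler0.
Qed.

Lemma tm_sum r (Theta : tmodule iota r) (a : {poly F}) :
  Theta a = \sum_(k < size a) tcst iota (iota (a`_k)%:P) *: Theta 'X^k.
Proof.
rewrite -[a in LHS]coefK poly_def raddf_sum; apply: eq_bigr => k _ /=.
by rewrite -mul_polyC rmorphM /= tm_alg; exact: mul_scalar_mx.
Qed.

Lemma biderMX D a : bider D (a * 'X) = Psi 'X *m bider D a + D *m Phi a.
Proof.
rewrite (@biderE _ (size a).+1); last first.
  by have [->|] := eqVneq a 0; rewrite ?mul0r ?size_poly0 // => /size_mulX->.
rewrite big_ord_recl coefMX rmorph0 tcst0 scale0r add0r.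
rewrite (tm_sum Phi a) /bider !mulmx_sumr -big_split; apply: eq_bigr => k _.
rewrite coefMX /= !tcst_scale_mul -scalerDr; congr (_ *: _).
rewrite big_ord_recl subn0 expr0 rmorph1 mul1mx addrC; congr (_ + _).
rewrite mulmx_sumr; apply: eq_bigr => i _.
by rewrite !mulmxA exprS rmorphM subnDA subn1.
Qed.

Lemma biderX D : bider D 'X = D.
Proof. by rewrite -['X]mul1r biderMX -polyC1 biderC mulmx0 add0r rmorph1 mulmx1. Qed.

Lemma bider_Der D : Der (bider D).
Proof.
split=> [|a b]; first exact: bider_lin.
have biderD x y : bider D (x + y) = bider D x + bider D y.
  by rewrite -[x]scale1r bider_lin !scale1r rmorph1 scale1r.
elim/poly_ind: a => [|a c IH].
  by rewrite mul0r bider0 !raddf0 mul0mx mul0mx addr0.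
rewrite mulrDl !biderD biderC addr0 mulrAC !biderMX IH mul_polyC.
have -> : Psi (a * 'X + c%:P) = Psi 'X *m Psi a + (tcst iota (iota c%:P))%:M.
  by rewrite mulrC rmorphD rmorphM /= tm_alg.
have -> : Phi (a * b) = Phi a *m Phi b by apply: rmorphM.
rewrite -[c *: b]addr0 bider_lin bider0 addr0 !mulmxDl mulmxDr mul_scalar_mx.
by rewrite !mulmxA -!addrA; congr (_ + _); rewrite addrA addrC.
Qed.

Lemma Der_bider delta : Der delta -> forall a, delta a = bider (delta 'X) a.
Proof.
case=> lin leib.
have d0 : delta 0 = 0.
  have := lin 1 0 0; rewrite scaler0 addr0 rmorph1 scale1r => /eqP.
  by rewrite -subr_eq0 opprD addrA subrr sub0r oppr_eq0 => /eqP.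
have d1 : delta 1 = 0.
  have := leib 1 1; rewrite mulr1 !rmorph1 mul1mx mulmx1 => /eqP.
  by rewrite -subr_eq0 opprD addrA subrr sub0r oppr_eq0 => /eqP.
elim/poly_ind=> [|a c IH]; first by rewrite d0 bider0.
rewrite addrC -[c%:P]mulr1 mul_polyC lin bider_lin d1 -polyC1 biderC.
by rewrite !scaler0 !add0r mulrC leib IH [_ * a]mulrC biderMX.
Qed.

End Biderivations.

Section ExtStructures.
Variables (F : finFieldType) (L : fieldType) (iota : {rmorphism {poly F} -> L}).
Local Notation S := (twisted iota).
Variables (d e : nat) (Phi : tmodule iota d) (Psi : tmodule iota e).
Variables (m : nat) (Theta : tmodule iota m) (b : 'I_m -> 'M[S]_(e, d)).

Definition rep (x : 'cV[L]_m) : {poly F} -> 'M[S]_(e, d) :=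
  bider Phi Psi (\sum_i tcst iota (x i 0) *: b i).

(* x |-> [rep x] is an isomorphism of F[t]-modules from L^m, on which F[t]    *)
(* acts through Theta, onto num / den, on which a acts by delta |-> Psi_a     *)
(* delta.  It is F-linear by construction.                                    *)
Definition identifies (num den : ({poly F} -> 'M[S]_(e, d)) -> Prop) : Prop :=
  [/\ forall x, num (rep x),
      forall delta, num delta -> exists x, den (delta \- rep x),
      forall x y, den (rep x \- rep y) -> x = y
    & forall a x, den ((fun c => Psi a *m rep x c)
                         \- rep (mx_eval (Theta a) x))].

End ExtStructures.

Section TModuleStructures.
Variables (F : finFieldType) (L : fieldType) (iota : {rmorphism {poly F} -> L}).
Local Notation S := (twisted iota).
Variables (d e : nat) (Phi : tmodule iota d) (Psi : tmodule iota e).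

Definition rep_over (K : fieldType) (j : {rmorphism L -> K}) m
    (b : 'I_m -> 'M[S]_(e, d)) (x : 'cV[K]_m) :
    {poly F} -> 'M[twisted (bc_iota iota j)]_(e, d) :=
  rep (bc_tm j Phi) (bc_tm j Psi) (fun i => bc_mx j (b i)) x.

(* Theta is a natural t-module structure on Ext^1_tau(Phi, Psi), resp. on     *)
(* Ext^1_{0,tau}(Phi, Psi): the coordinates are those of an L-linear family   *)
(* of representatives delta(t) = \sum_i x_i b_i, and they identify the        *)
(* F[t]-modules not only over L but over every field extension K / L.  An     *)
(* unrestricted F-linear bijection with L^m would not determine Theta up to   *)
(* isomorphism of t-modules: L^m and L^(m + 1) can be isomorphic over F, and  *)
(* for finite L the map x |-> x ^+ q ^ i can be the identity.                 *)
Definition Ext_structure m (Theta : tmodule iota m)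
    (b : 'I_m -> 'M[S]_(e, d)) : Prop :=
  forall (K : fieldType) (j : {rmorphism L -> K}),
    identifies (bc_tm j Phi) (bc_tm j Psi) (bc_tm j Theta)
      (fun i => bc_mx j (b i))
      (Der (bc_tm j Phi) (bc_tm j Psi)) (Der_in (bc_tm j Phi) (bc_tm j Psi)).

Definition Ext0_structure m (Theta : tmodule iota m)
    (b : 'I_m -> 'M[S]_(e, d)) : Prop :=
  forall (K : fieldType) (j : {rmorphism L -> K}),
    identifies (bc_tm j Phi) (bc_tm j Psi) (bc_tm j Theta)
      (fun i => bc_mx j (b i))
      (Der0 (bc_tm j Phi) (bc_tm j Psi)) (Der0_in (bc_tm j Phi) (bc_tm j Psi)).

(* In the given coordinates, f is the map Ext^1_{0,tau}(Phi, Psi) ->          *)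
(* Ext^1_tau(Phi, Psi) induced by the inclusion of Der_0 in Der.              *)
Definition is_Ext0_to_Ext m0 m1 (b0 : 'I_m0 -> 'M[S]_(e, d))
    (b1 : 'I_m1 -> 'M[S]_(e, d)) (f : 'M[S]_(m1, m0)) : Prop :=
  forall (K : fieldType) (j : {rmorphism L -> K}) (x : 'cV[K]_m0),
    Der_in (bc_tm j Phi) (bc_tm j Psi)
      (rep_over j b0 x \- rep_over j b1 (mx_eval (bc_mx j f) x)).

End TModuleStructures.

Section Dual.
Variables (F : finFieldType) (L : fieldType) (iota : {rmorphism {poly F} -> L}).
Local Notation S := (twisted iota).

(* The row vectors tau^i e_k for 0 < i < n.  When the leading coefficient of  *)
(* Phi_t is invertible and n = deg Phi, every class of Ext^1_{0,tau}(Phi, C)  *)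
(* has exactly one representative whose value at t is an L-linear combination *)
(* of them.                                                                   *)
Definition dual_basis n d (l : 'I_(n.-1 * d)) : 'M[S]_(1, d) :=
  \row_k \sum_(i < n.-1 | l == mxvec_index i k) tau iota ^+ i.+1.

Definition is_dual d (Phi : tmodule iota d)
    (Phiv : tmodule iota ((tm_deg Phi).-1 * d)) : Prop :=
  Ext0_structure Phi (Carlitz iota) Phiv (@dual_basis (tm_deg Phi) d).

(* f is the map [delta] |-> [delta beta] from Psi^v to Phi^v.                 *)
Definition is_dual_map d e (Phi : tmodule iota d) (Psi : tmodule iota e)
    (beta : 'M[S]_(e, d))
    (f : 'M[S]_((tm_deg Phi).-1 * d, (tm_deg Psi).-1 * e)) : Prop :=
  forall (K : fieldType) (j : {rmorphism L -> K})
         (x : 'cV[K]_((tm_deg Psi).-1 * e)),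
    Der0_in (bc_tm j Phi) (bc_tm j (Carlitz iota))
      ((fun a => rep_over Psi (Carlitz iota) j (@dual_basis (tm_deg Psi) e) x a
                   *m bc_mx j beta)
       \- rep_over Phi (Carlitz iota) j (@dual_basis (tm_deg Phi) d)
            (mx_eval (bc_mx j f) x)).

End Dual.

Arguments dual_basis {F L} iota n d l.
Arguments is_dual {F L iota d} Phi Phiv.
Arguments is_dual_map {F L iota d e} Phi Psi beta f.

(* Main.v *)
(* Write x^(k) for the entrywise q^k-th power.  Let M_n be the leading          *)
(* coefficient of Phi_t, n >= 2.  The inner biderivation of u tau^k is          *)
(* u M_n^(k) tau^(k+n) plus lower terms, because C_t only raises degrees by 1.  *)
(* As M_n is invertible, every biderivation reduces uniquely to one of          *)
(* degree < n, whose coefficients are coordinates on Ext^1(Phi, C).  Without    *)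
(* nilpotence inner biderivations have no constant term, so the constant term   *)
(* gives the quotient Ga^d, and reducing C_t x in degrees 1, ..., n - 1 gives   *)
(* the matrix of Phi^v.                                                         *)
(*   The leading coefficient of Phi^v is not invertible for n >= 3, but if the  *)
(* n - 1 blocks of a row are ordered by degree and, in each degree, from the    *)
(* last block to the first, then U |-> U Phi^v_t - C_t U again shifts leading   *)
(* terms by n.  The normal forms without constant term are the z M_n^-T tau     *)
(* in the last block, and in the coordinate z the action of t is Phi_t:         *)
(* biduality is the identity matrix.                                            *)
(*   Reduction is polynomial in the coefficients, hence delta |-> delta beta is *)
(* given by a twisted matrix; it commutes with t because it does so at the      *)
(* generic point over L(X).                                                     *)
From HB Require Import structures.
Require Import Defs.
From mathcomp Require Import all_boot all_order all_algebra all_field.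

Set Implicit Arguments.
Unset Strict Implicit.
Unset Printing Implicit Defensive.

Import GRing.Theory.
Local Open Scope ring_scope.

(** * Matrices of twisted polynomials *)

(** A biderivation is determined by its value at t, so Ext^1(Phi, C) is the cokernel of [inn], U |->
    U Phi_t - C_t U ([Der_inP]). As C_t has tau-degree 1 < n and the leading coefficient of Phi_t is
    invertible, [inn] is triangular with invertible diagonal blocks and shifts degrees by n. Hence
    it is injective, and the coefficients in degrees 0, ..., n - 1 are coordinates on its cokernel
    ([triangular_inj], [triangular_surj]). Without nilpotence [inn U] has no constant term
    ([inn_const0]), so taking constant terms maps Ext^1 onto Ga^d with kernel Ext^1_0. The record
    [presents] packages such normal forms, and [presents_Ext0], [presents_Ext] and [ext_exact] turn
    it into the t-module structures and the exact sequence. Part (a) is the instance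
    [dual_presents], part (b) the instance [bidual_presents]. In the latter a suitable order of the
    block coordinates makes [inn] triangular again ([bidual_coord_lead]); one block of size d
    survives besides the constant term, and t acts on it by Phi_t. For (c), right multiplication by
    beta preserves inner biderivations, and reduction to normal form is given by a twisted matrix
    ([reduce_row], [reduce_mulr]). That this matrix commutes with t is checked on points over
    extension fields ([mx_eval_inj]), where it follows from uniqueness of normal forms. The explicit
    matrices commute with base change, so the same normal forms serve every extension K / L. *)

Section FrobeniusTwist.
Variables (F : finFieldType) (L : fieldType) (iota : {rmorphism {poly F} -> L}).
Local Notation S := (twisted iota).

(** A named iterate, so that it can carry a ring morphism structure and act on matrices through
    [map_mx]. *)
Definition frobi (i : nat) : L -> L := iter i (frob iota).

Fact frobi_is_nmod_morphism i : nmod_morphism (frobi i).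
Proof. by split=> [|x y]; rewrite /frobi ?skew_iter0 ?skew_iterD. Qed.

Fact frobi_is_monoid_morphism i : monoid_morphism (frobi i).
Proof. by split=> [|x y]; rewrite /frobi ?skew_iter1 ?skew_iterM. Qed.

HB.instance Definition _ i :=
  GRing.isNmodMorphism.Build L L (frobi i) (frobi_is_nmod_morphism i).
HB.instance Definition _ i :=
  GRing.isMonoidMorphism.Build L L (frobi i) (frobi_is_monoid_morphism i).

Lemma frobiE i x : frobi i x = x ^+ (#|F| ^ i).
Proof.
elim: i => [|i IH]; first by rewrite expr1.
by rewrite /frobi iterS -/(frobi i x) IH /frob -exprM expnSr.
Qed.

Lemma frobi_add i k x : frobi i (frobi k x) = frobi (i + k) x.
Proof. by rewrite /frobi iterD. Qed.

Definition frobm i m n (A : 'M[L]_(m, n)) : 'M[L]_(m, n) := map_mx (frobi i) A.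

Lemma frobm0 m n (A : 'M[L]_(m, n)) : frobm 0 A = A.
Proof. by apply/matrixP=> i j; rewrite mxE. Qed.

Lemma frobm_add i k m n (A : 'M[L]_(m, n)) : frobm i (frobm k A) = frobm (i + k) A.
Proof. by apply/matrixP=> a b; rewrite !mxE frobi_add. Qed.

Lemma skew_coefB (p q : S) k :
  skew_coef (p - q) k = skew_coef p k - skew_coef q k.
Proof. by rewrite /skew_coef [skew_val (p - q)]/= coefB. Qed.

Lemma skew_coef0 k : skew_coef (0 : S) k = 0.
Proof. by rewrite /skew_coef coef0. Qed.

Lemma skew_coef_sum I (r : seq I) (P : pred I) (f : I -> S) k :
  skew_coef (\sum_(i <- r | P i) f i) k = \sum_(i <- r | P i) skew_coef (f i) k.
Proof.
by elim/big_rec2: _ => [|i x y _ <-]; rewrite ?skew_coef0 ?skew_coefD.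
Qed.

Lemma skew_coef_tauM (p : S) k :
  skew_coef (tau iota * p) k = if k is k'.+1 then frob iota (skew_coef p k') else 0.
Proof.
rewrite skew_coefM; case: k => [|k].
  by rewrite big_ord1 skew_coef_mon mul0r.
rewrite !big_ord_recl !skew_coef_mon mul0r add0r mul1r /bump /= subSS subn0.
by rewrite big1 ?addr0 // => i _; rewrite skew_coef_mon mul0r.
Qed.

Lemma skew_coef_tauX i k : skew_coef (tau iota ^+ i) k = (k == i)%:R.
Proof.
elim: i k => [|i IH] k.
  by rewrite expr0 skew_coef_mon; case: eqP.
by rewrite exprS skew_coef_tauM; case: k => // k; rewrite IH rmorph_nat.
Qed.

Lemma tau_tcst c : tau iota * tcst iota c = tcst iota (frob iota c) * tau iota.
Proof.
apply: skew_polyP => k; rewrite skew_coef_tauM coef_tcstM !skew_coef_mon.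
case: k => [|[|k]] //=; rewrite ?skew_coef_mon ?mulr0 ?mulr1 //=.
by rewrite rmorph0.
Qed.

Lemma tcst1 : tcst iota 1 = 1. Proof. by []. Qed.

Section Mx.
Variables m n : nat.
Implicit Type A B : 'M[S]_(m, n).

Lemma mx_coefP A B : (forall k, mx_coef A k = mx_coef B k) -> A = B.
Proof.
move=> eqAB; apply/matrixP=> i j; apply: skew_polyP => k.
by have /matrixP/(_ i j) := eqAB k; rewrite !mxE.
Qed.

Lemma mx_coefD A B k : mx_coef (A + B) k = mx_coef A k + mx_coef B k.
Proof. by apply/matrixP=> i j; rewrite !mxE skew_coefD. Qed.

Lemma mx_coefB A B k : mx_coef (A - B) k = mx_coef A k - mx_coef B k.
Proof. by apply/matrixP=> i j; rewrite !mxE skew_coefB. Qed.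

Lemma mx_coef0 k : mx_coef (0 : 'M[S]_(m, n)) k = 0.
Proof. by apply/matrixP=> i j; rewrite !mxE skew_coef0. Qed.

Lemma mx_coef_sum I (r : seq I) (P : pred I) (f : I -> 'M[S]_(m, n)) k :
  mx_coef (\sum_(i <- r | P i) f i) k = \sum_(i <- r | P i) mx_coef (f i) k.
Proof.
by elim/big_rec2: _ => [|i x y _ <-]; rewrite ?mx_coef0 ?mx_coefD.
Qed.

Lemma mx_coef_tcstZ c A k : mx_coef (tcst iota c *: A) k = c *: mx_coef A k.
Proof. by apply/matrixP=> i j; rewrite !mxE coef_tcstM. Qed.

Lemma mx_coef_tauZ A k :
  mx_coef (tau iota *: A) k = if k is k'.+1 then frobm 1 (mx_coef A k') else 0.
Proof. by case: k => [|k]; apply/matrixP=> i j; rewrite !mxE skew_coef_tauM. Qed.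

Lemma mx_coef_deg A k : (mx_deg A < k)%N -> mx_coef A k = 0.
Proof.
move=> ltk; apply/matrixP=> i j; rewrite !mxE /skew_coef nth_default //.
have : ((skew_size (A i j)).-1 < k)%N.
  apply: leq_ltn_trans ltk.
  apply: leq_trans (leq_bigmax i).
  exact: (leq_bigmax (F := fun j => (skew_size (A i j)).-1) j).
by rewrite /skew_size; case: size => // s; rewrite ltnS /= => /ltnW.
Qed.

Definition mx_tw (N : nat) (M : nat -> 'M[L]_(m, n)) : 'M[S]_(m, n) :=
  \matrix_(i, j) SkewPoly (frob iota) (\poly_(k < N) M k i j).

Lemma mx_coef_tw N M k : mx_coef (mx_tw N M) k = if (k < N)%N then M k else 0.
Proof.
by apply/matrixP=> i j; rewrite !mxE /skew_coef coef_poly; case: ifP; rewrite ?mxE.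
Qed.

End Mx.

Lemma mx_coefM m n r (A : 'M[S]_(m, n)) (B : 'M[S]_(n, r)) k :
  mx_coef (A *m B) k =
  \sum_(i < k.+1) mx_coef A i *m frobm i (mx_coef B (k - i)).
Proof.
apply/matrixP=> a b; rewrite !mxE skew_coef_sum summxE.
under eq_bigr do rewrite skew_coefM.
rewrite exchange_big; apply: eq_bigr => i _; rewrite !mxE.
by apply: eq_bigr => c _; rewrite !mxE.
Qed.

Lemma tw_evalE N (p : S) x : (skew_size p <= N)%N ->
  tw_eval p x = \sum_(i < N) skew_coef p i * frobi i x.
Proof.
move=> le_pN; rewrite /tw_eval.
rewrite (big_ord_widen _ (fun i => skew_coef p i * x ^+ (#|F| ^ i)) le_pN).
rewrite big_mkcond; apply: eq_bigr => i _ /=; rewrite frobiE.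
by case: ltnP => // le_pi; rewrite /skew_coef nth_default ?mul0r.
Qed.

Lemma tw_evalDl (p q : S) x : tw_eval (p + q) x = tw_eval p x + tw_eval q x.
Proof.
pose N := maxn (skew_size p) (skew_size q).
rewrite (@tw_evalE N) ?size_polyD //.
rewrite (@tw_evalE N p) ?leq_maxl // (@tw_evalE N q) ?leq_maxr // -big_split.
by apply: eq_bigr => i _; rewrite skew_coefD mulrDl.
Qed.

Lemma tw_eval0l x : tw_eval (0 : S) x = 0.
Proof. by rewrite (@tw_evalE 0) ?big_ord0 // /skew_size size_poly0. Qed.

Lemma tw_eval_suml I (r : seq I) (P : pred I) (f : I -> S) x :
  tw_eval (\sum_(i <- r | P i) f i) x = \sum_(i <- r | P i) tw_eval (f i) x.
Proof.
by elim/big_rec2: _ => [|i y z _ <-]; rewrite ?tw_eval0l ?tw_evalDl.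
Qed.

Fact tw_eval_is_nmod_morphism p : nmod_morphism (tw_eval (p : S)).
Proof.
split=> [|x y].
  by rewrite (tw_evalE _ (leqnn _)) big1 // => i _; rewrite rmorph0 mulr0.
rewrite !(tw_evalE _ (leqnn _)) -big_split; apply: eq_bigr => i _.
by rewrite rmorphD mulrDr.
Qed.

Lemma tw_evalDr p x y : tw_eval (p : S) (x + y) = tw_eval p x + tw_eval p y.
Proof. exact: (tw_eval_is_nmod_morphism p).2. Qed.

Lemma tw_eval0r p : tw_eval (p : S) 0 = 0.
Proof. exact: (tw_eval_is_nmod_morphism p).1. Qed.

Lemma tw_eval_sumr I (r : seq I) (P : pred I) (f : I -> L) (p : S) :
  tw_eval p (\sum_(i <- r | P i) f i) = \sum_(i <- r | P i) tw_eval p (f i).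
Proof.
by elim/big_rec2: _ => [|i y z _ <-]; rewrite ?tw_eval0r ?tw_evalDr.
Qed.

Lemma skew_coef_monM c i (p : S) k :
  skew_coef ((skew_mon (frob iota) c i : S) * p) k =
  if (i <= k)%N then c * frobi i (skew_coef p (k - i)) else 0.
Proof.
rewrite skew_coefM; case: leqP => [le_ik|lt_ki].
  rewrite (bigD1 (Ordinal (le_ik : (i < k.+1)%N))) //= skew_coef_mon eqxx.
  rewrite big1 ?addr0 // => a /negPf ne_ai; rewrite skew_coef_mon.
  by rewrite -[_ == _]/(a == Ordinal (le_ik : (i < k.+1)%N)) ne_ai mul0r.
rewrite big1 // => a _; rewrite skew_coef_mon ltn_eqF ?mul0r //.
exact: leq_ltn_trans (leq_ord a) lt_ki.
Qed.

Lemma skew_mon_sum N (p : S) : (skew_size p <= N)%N ->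
  p = \sum_(i < N) (skew_mon (frob iota) (skew_coef p i) i : S).
Proof.
move=> le_pN; apply: skew_polyP => k; rewrite skew_coef_sum.
case: (ltnP k N) => [ltkN|leNk].
  rewrite (bigD1 (Ordinal ltkN)) //= skew_coef_mon eqxx big1 ?addr0 // => i.
  by rewrite skew_coef_mon -val_eqE /= eq_sym => /negPf->.
rewrite {1}/skew_coef nth_default ?(leq_trans le_pN) // big1 // => i _.
by rewrite skew_coef_mon gtn_eqF // (leq_trans (ltn_ord i)).
Qed.

(** The product of L{tau} is composition of additive polynomials: the rule tau c = c^q tau is (c
    x)^q = c^q x^q. By additivity it suffices to treat monomials on the left. *)
Lemma tw_evalM (p q : S) x : tw_eval (p * q) x = tw_eval p (tw_eval q x).
Proof.
rewrite [in LHS](skew_mon_sum (leqnn (skew_size p))) mulr_suml tw_eval_suml.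
rewrite [RHS](tw_evalE _ (leqnn _)); apply: eq_bigr => i _.
set c := skew_coef p i.
have le_size : (skew_size ((skew_mon (frob iota) c i : S) * q)%R <= i + skew_size q)%N.
  apply/leq_sizeP => k le_k; rewrite -/(skew_coef _ k) skew_coef_monM.
  case: leqP => // _; rewrite {1}/skew_coef nth_default ?rmorph0 ?mulr0 //.
  by rewrite leq_subRL // (leq_trans _ le_k) ?leq_addr.
rewrite (tw_evalE _ le_size) big_split_ord /= big1 ?add0r => [|k _]; last first.
  by rewrite skew_coef_monM leqNgt ltn_ord mul0r.
rewrite (tw_evalE _ (leqnn _)) rmorph_sum mulr_sumr; apply: eq_bigr => k _ /=.
by rewrite skew_coef_monM leq_addr addKn rmorphM /= frobi_add mulrA.
Qed.

Lemma mx_evalDl m n (A B : 'M[S]_(m, n)) x :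
  mx_eval (A + B) x = mx_eval A x + mx_eval B x.
Proof.
apply/matrixP=> i j; rewrite !mxE -big_split; apply: eq_bigr => k _.
by rewrite !mxE tw_evalDl.
Qed.

Lemma mx_evalM m n r (A : 'M[S]_(m, n)) (B : 'M[S]_(n, r)) x :
  mx_eval (A *m B) x = mx_eval A (mx_eval B x).
Proof.
apply/matrixP=> i j; rewrite !mxE.
under eq_bigr do rewrite !mxE tw_eval_suml.
rewrite exchange_big; apply: eq_bigr => k _; rewrite !mxE tw_eval_sumr.
by apply: eq_bigr => l _; rewrite tw_evalM.
Qed.

Lemma mx_evalE N m n (A : 'M[S]_(m, n)) x :
  (forall k, (N <= k)%N -> mx_coef A k = 0) ->
  mx_eval A x = \sum_(k < N) mx_coef A k *m frobm k x.
Proof.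
move=> hA; apply/colP=> i; rewrite !mxE summxE.
under [RHS]eq_bigr do rewrite mxE.
rewrite exchange_big; apply: eq_bigr => l _.
rewrite (@tw_evalE N); first by apply: eq_bigr => k _; rewrite !mxE.
by apply/leq_sizeP => k /hA/matrixP/(_ i l); rewrite !mxE.
Qed.

Lemma tw_eval_tcst c x : tw_eval (tcst iota c : S) x = c * x.
Proof.
rewrite (@tw_evalE 1) ?big_ord1 ?skew_coef_mon //.
by apply/leq_sizeP => -[|k] // _; rewrite -/(skew_coef _ _) skew_coef_mon.
Qed.

Lemma tw_eval_tau x : tw_eval (tau iota : S) x = frob iota x.
Proof.
rewrite (@tw_evalE 2) ?big_ord_recr ?big_ord0 /= ?skew_coef_mon /= ?mul0r ?add0r ?mul1r //.
by apply/leq_sizeP => -[|[|k]] // _; rewrite -/(skew_coef _ _) skew_coef_mon.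
Qed.

Lemma mx_eval_scalar n c x : mx_eval ((tcst iota c)%:M : 'M[S]_n) x = c *: x.
Proof.
apply/colP=> i; rewrite !mxE (bigD1 i) //= mxE eqxx mulr1n tw_eval_tcst.
by rewrite big1 ?addr0 // => j ne_ji; rewrite mxE eq_sym (negPf ne_ji) mulr0n tw_eval0l.
Qed.

Lemma mx_eval1 n x : mx_eval (1%:M : 'M[S]_n) x = x.
Proof. by rewrite -tcst1 mx_eval_scalar scale1r. Qed.

Lemma mx_eval0l m n x : mx_eval (0 : 'M[S]_(m, n)) x = 0.
Proof. by apply/colP=> i; rewrite !mxE big1 // => j _; rewrite mxE tw_eval0l. Qed.

Lemma mx_eval0r m n (A : 'M[S]_(m, n)) : mx_eval A 0 = 0.
Proof. by apply/colP=> i; rewrite !mxE big1 // => j _; rewrite mxE tw_eval0r. Qed.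

Lemma mx_eval_col m1 m2 n (A : 'M[S]_(m1, n)) (B : 'M[S]_(m2, n)) x :
  mx_eval (col_mx A B) x = col_mx (mx_eval A x) (mx_eval B x).
Proof.
apply/colP=> i; rewrite !mxE; case: split_ordP => k ->; rewrite !mxE;
  apply: eq_bigr => j _; by rewrite ?col_mxEu ?col_mxEd.
Qed.

Lemma mx_eval_row m n1 n2 (A : 'M[S]_(m, n1)) (B : 'M[S]_(m, n2)) x y :
  mx_eval (row_mx A B) (col_mx x y) = mx_eval A x + mx_eval B y.
Proof.
apply/colP=> i; rewrite !mxE big_split_ord; congr (_ + _); apply: eq_bigr => j _;
  by rewrite ?row_mxEl ?row_mxEr ?col_mxEu ?col_mxEd.
Qed.

End FrobeniusTwist.

(** * Base change and inner biderivations *)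

Section BaseChangeMorphism.
Variables (F : finFieldType) (L : fieldType) (iota : {rmorphism {poly F} -> L}).
Variables (K : fieldType) (j : {rmorphism L -> K}).
Local Notation bci := (bc_iota iota j).

Lemma skew_coef_bc (p : twisted iota) k : skew_coef (bc_tw j p) k = j (skew_coef p k).
Proof. by rewrite /skew_coef coef_map. Qed.

Lemma frobi_bc i x : frobi bci i (j x) = j (frobi iota i x).
Proof. by rewrite !frobiE rmorphXn. Qed.

Fact bc_tw_is_nmod_morphism : nmod_morphism (@bc_tw F L iota K j).
Proof.
split=> [|p q]; apply: skew_polyP => k; rewrite ?skew_coefD !skew_coef_bc.
  by rewrite !skew_coef0 rmorph0.
by rewrite skew_coefD rmorphD.
Qed.

Fact bc_tw_is_monoid_morphism : monoid_morphism (@bc_tw F L iota K j).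
Proof.
split=> [|p q]; apply: skew_polyP => k.
  by rewrite skew_coef_bc !skew_coef_mon; case: eqP; rewrite ?rmorph1 ?rmorph0.
rewrite skew_coef_bc !skew_coefM rmorph_sum; apply: eq_bigr => i _.
by rewrite !skew_coef_bc rmorphM -!/(frobi _ _ _) frobi_bc.
Qed.

HB.instance Definition _ := GRing.isNmodMorphism.Build
  (twisted iota) (twisted bci) (@bc_tw F L iota K j) bc_tw_is_nmod_morphism.
HB.instance Definition _ := GRing.isMonoidMorphism.Build
  (twisted iota) (twisted bci) (@bc_tw F L iota K j) bc_tw_is_monoid_morphism.

Lemma bc_tw_tcst c : bc_tw j (tcst iota c) = tcst bci (j c).
Proof.
apply: skew_polyP => k; rewrite skew_coef_bc !skew_coef_mon.
by case: eqP; rewrite ?rmorph0.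
Qed.

Lemma bc_tw_tau : bc_tw j (tau iota) = tau bci.
Proof.
apply: skew_polyP => k; rewrite skew_coef_bc !skew_coef_mon.
by case: eqP; rewrite ?rmorph0 ?rmorph1.
Qed.

Lemma mx_coef_bc m n (A : 'M[twisted iota]_(m, n)) k :
  mx_coef (bc_mx j A) k = map_mx j (mx_coef A k).
Proof. by apply/matrixP=> a b; rewrite !mxE skew_coef_bc. Qed.

Lemma frobm_bc i m n (A : 'M[L]_(m, n)) :
  frobm bci i (map_mx j A) = map_mx j (frobm iota i A).
Proof. by apply/matrixP=> a b; rewrite !mxE frobi_bc. Qed.

Lemma bc_mxM m n r (A : 'M[twisted iota]_(m, n)) (B : 'M_(n, r)) :
  bc_mx j (A *m B) = bc_mx j A *m bc_mx j B.
Proof. exact: map_mxM. Qed.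

Lemma bc_tmX d (Phi : tmodule iota d) : bc_tm j Phi 'X = bc_mx j (Phi 'X).
Proof. exact: tm_homX. Qed.

Lemma bc_delta_mx m n a b :
  bc_mx j (delta_mx a b : 'M[twisted iota]_(m, n)) = delta_mx a b.
Proof.
apply/matrixP=> u v; rewrite [LHS]mxE [delta_mx a b u v]mxE [RHS]mxE.
by case: (_ && _); rewrite ?rmorph1 ?rmorph0.
Qed.

End BaseChangeMorphism.

(** The value at t of the inner biderivation of U. It is locked so that unification does not unfold
    it into matrix products. *)
HB.lock Definition inn (F : finFieldType) (L : fieldType)
  (iota : {rmorphism {poly F} -> L}) d e (Phi : tmodule iota d) (Psi : tmodule iota e)
  (U : 'M[twisted iota]_(e, d)) : 'M[twisted iota]_(e, d) :=
  U *m Phi 'X - Psi 'X *m U.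

Section InnerBiderivations.
Variables (F : finFieldType) (L : fieldType) (iota : {rmorphism {poly F} -> L}).
Local Notation S := (twisted iota).
Variables (d e : nat) (Phi : tmodule iota d) (Psi : tmodule iota e).
Implicit Types (U D : 'M[S]_(e, d)) (delta : {poly F} -> 'M[S]_(e, d)).

Local Notation inn := (inn Phi Psi).

Lemma innD U V : inn (U + V) = inn U + inn V.
Proof. by rewrite !inn.unlock mulmxDl mulmxDr opprD addrACA. Qed.

Lemma innB U V : inn (U - V) = inn U - inn V.
Proof. by apply/eqP; rewrite eq_sym subr_eq -innD subrK. Qed.

Lemma inn0 : inn 0 = 0.
Proof. by rewrite !inn.unlock mul0mx mulmx0 subrr. Qed.

Lemma tm_mapC m (Theta : tmodule iota m) a b :
  Theta a *m Theta b = Theta b *m Theta a.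
Proof. by rewrite -[LHS](rmorphM Theta) mulrC [LHS]rmorphM. Qed.

Lemma inn_mul a U : Psi a *m inn U = inn (Psi a *m U).
Proof. by rewrite !inn.unlock mulmxBr !mulmxA tm_mapC. Qed.

Lemma inner_Der U : Der Phi Psi (fun a => U *m Phi a - Psi a *m U).
Proof.
split=> [c a b|a b].
  rewrite -mul_polyC !rmorphD !rmorphM /= !tm_alg.
  rewrite -[_ * Phi a]/(_ *m _) -[_ * Psi a]/(_ *m _) !mul_scalar_mx.
  by rewrite mulmxDr mulmxDl tcst_scale_mul -scalemxAl scalerBr opprD addrACA.
have -> : Phi (a * b) = Phi a *m Phi b by exact: rmorphM.
have -> : Psi (a * b) = Psi a *m Psi b by exact: rmorphM.
by rewrite mulmxBr mulmxBl !mulmxA [RHS]addrC [RHS]addrA subrK.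
Qed.

Lemma DerB delta1 delta2 :
  Der Phi Psi delta1 -> Der Phi Psi delta2 -> Der Phi Psi (delta1 \- delta2).
Proof.
case=> lin1 leib1 [lin2 leib2]; split=> [c a b|a b] /=.
  by rewrite lin1 lin2 scalerBr opprD addrACA.
by rewrite leib1 leib2 mulmxBl mulmxBr opprD addrACA.
Qed.

Lemma Der_mull a delta : Der Phi Psi delta -> Der Phi Psi (fun b => Psi a *m delta b).
Proof.
case=> lin leib; split=> [c x y|x y] /=.
  by rewrite lin mulmxDr tcst_scale_mul.
by rewrite leib mulmxDr !mulmxA tm_mapC.
Qed.

(** Two biderivations that agree at t are equal, so being inner can be tested at t. This turns all
    questions about Ext into questions about matrices. *)
Lemma Der_inP delta : Der Phi Psi delta ->
  Der_in Phi Psi delta <-> exists U, delta 'X = inn U.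
Proof.
move=> derd; split=> [[U dU]|[U dU]]; exists U; first by rewrite inn.unlock dU.
move=> a; rewrite (Der_bider derd) dU inn.unlock.
exact: esym (Der_bider (inner_Der U) a).
Qed.

Section Representatives.
Variables (m : nat) (b : 'I_m -> 'M[S]_(e, d)).

Definition rvec (x : 'cV[L]_m) : 'M[S]_(e, d) := \sum_i tcst iota (x i 0) *: b i.

Lemma rvecD x y : rvec (x + y) = rvec x + rvec y.
Proof.
by rewrite -big_split; apply: eq_bigr => i _; rewrite mxE tcstD scalerDl.
Qed.

Lemma rvecB x y : rvec (x - y) = rvec x - rvec y.
Proof. by apply/eqP; rewrite eq_sym subr_eq -rvecD subrK. Qed.

Lemma rvec0 : rvec 0 = 0.
Proof. by have := rvecB 0 0; rewrite !subrr. Qed.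

Lemma rvecZ c x : rvec (c *: x) = tcst iota c *: rvec x.
Proof.
by rewrite scaler_sumr; apply: eq_bigr => i _; rewrite mxE tcstM scalerA.
Qed.

Lemma repX x : rep Phi Psi b x 'X = rvec x.
Proof. exact: biderX. Qed.

Lemma rep_Der x : Der Phi Psi (rep Phi Psi b x).
Proof. exact: bider_Der. Qed.

Lemma mx_coef_rvec x k : mx_coef (rvec x) k = \sum_i x i 0 *: mx_coef (b i) k.
Proof.
by rewrite mx_coef_sum; apply: eq_bigr => i _; rewrite mx_coef_tcstZ.
Qed.

Lemma eq_rvec b' x : (forall i, b i = b' i) -> rvec x = \sum_i tcst iota (x i 0) *: b' i.
Proof. by move=> eqb; apply: eq_bigr => i _; rewrite eqb. Qed.

Hypothesis Theta : tmodule iota m.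
Hypothesis act : forall x, exists U,
  Psi 'X *m rvec x = rvec (mx_eval (Theta 'X) x) + inn U.

(** Horner induction on [a]: it is enough to know the action of t, because left multiplication by
    [Psi a] preserves inner biderivations ([inn_mul]). *)
Lemma rvec_act a x : exists U, Psi a *m rvec x = rvec (mx_eval (Theta a) x) + inn U.
Proof.
elim/poly_ind: a x => [|a c IH] x.
  by exists 0; rewrite !rmorph0 mul0mx mx_eval0l rvec0 inn0 addr0.
have [U eU] := act x; have [V eV] := IH (mx_eval (Theta 'X) x).
exists (Psi a *m U + V).
rewrite !rmorphD !rmorphM /= !tm_alg mulmxDl mx_evalDl rvecD mx_eval_scalar rvecZ.
rewrite mul_scalar_mx -[Psi a * _]/(_ *m _) -[Theta a * _]/(_ *m _) -mulmxA eU.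
rewrite mulmxDr eV mx_evalM inn_mul innD.
move: (inn V) (inn (Psi a *m U)) => W W'; rewrite -!addrA; congr (_ + _).
by rewrite [LHS]addrC [LHS]addrAC [LHS]addrC.
Qed.

Hypothesis inj : forall x U, rvec x = inn U -> x = 0.

Lemma rep_inj x y : Der_in Phi Psi (rep Phi Psi b x \- rep Phi Psi b y) -> x = y.
Proof.
move/(Der_inP (DerB (rep_Der x) (rep_Der y)))=> [U /=].
by rewrite !repX -rvecB => /inj/eqP; rewrite subr_eq0 => /eqP.
Qed.

Lemma rep_act a x :
  Der_in Phi Psi ((fun c => Psi a *m rep Phi Psi b x c)
                    \- rep Phi Psi b (mx_eval (Theta a) x)).
Proof.
apply/(Der_inP (DerB (Der_mull a (rep_Der x)) (rep_Der _))).
have [U eU] := rvec_act a x.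
by exists U; rewrite /= !repX eU addrC addrA addNr add0r.
Qed.

Lemma identifies_Der :
  (forall D, exists x U, D = rvec x + inn U) ->
  identifies Phi Psi Theta b (Der Phi Psi) (Der_in Phi Psi).
Proof.
move=> surj; split; [exact: rep_Der| |exact: rep_inj|exact: rep_act].
move=> delta derd; have [x [U eD]] := surj (delta 'X).
exists x; apply/(Der_inP (DerB derd (rep_Der x))); exists U => /=.
by rewrite repX eD addrC addrA addNr add0r.
Qed.

Lemma identifies_Der0 :
  (forall U, mx_coef (inn U) 0 = 0) ->
  (forall i, mx_coef (b i) 0 = 0) ->
  (forall D, mx_coef D 0 = 0 -> exists x U, D = rvec x + inn U) ->
  identifies Phi Psi Theta b (Der0 Phi Psi) (Der0_in Phi Psi).
Proof.
move=> innc0 b0 surj.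
have rvec0 x : mx_coef (rvec x) 0 = 0.
  by rewrite mx_coef_rvec big1 // => i _; rewrite b0 scaler0.
have rep0 x : const0 (rep Phi Psi b x) by rewrite /const0 repX rvec0.
split.
- by move=> x; split; [exact: rep_Der | exact: rep0].
- move=> delta [derd delta0]; have [x [U eD]] := surj (delta 'X) delta0.
  exists x; split; last by rewrite /const0 /= mx_coefB delta0 repX rvec0 subr0.
  apply/(Der_inP (DerB derd (rep_Der x))); exists U => /=.
  by rewrite repX eD addrC addrA addNr add0r.
- by move=> x y [/rep_inj].
- move=> a x; split; first exact: rep_act.
  have [U eU] := rvec_act a x.
  by rewrite /const0 /= !repX eU addrC addrA addNr add0r innc0.
Qed.

End Representatives.
Lemma rvec_col_mx m1 m2 (b : 'I_(m1 + m2) -> 'M[S]_(e, d)) z x :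
  rvec b (col_mx z x) =
  rvec (fun i => b (lshift m2 i)) z + rvec (fun k => b (rshift m1 k)) x.
Proof.
transitivity (\sum_(i < m1) tcst iota (col_mx z x (lshift m2 i) 0) *: b (lshift m2 i)
  + \sum_(k < m2) tcst iota (col_mx z x (rshift m1 k) 0) *: b (rshift m1 k)).
  exact: big_split_ord.
by apply: (f_equal2 +%R); apply: eq_bigr => i _; rewrite ?col_mxEu ?col_mxEd.
Qed.

End InnerBiderivations.

(** * Extensions presented by normal forms *)

Section ConstantRows.
Variables (F : finFieldType) (L : fieldType) (iota : {rmorphism {poly F} -> L}).
Local Notation S := (twisted iota).

Definition cst_row d (x : 'cV[L]_d) : 'M[S]_(1, d) := map_mx (tcst iota) x^T.

Lemma mx_coef_cst_row d (x : 'cV[L]_d) k :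
  mx_coef (cst_row x) k = if k == 0%N then x^T else 0.
Proof.
by apply/matrixP=> i l; rewrite !mxE skew_coef_mon; case: eqP; rewrite !mxE.
Qed.

Lemma cst_row0 d : cst_row (0 : 'cV[L]_d) = 0.
Proof.
by apply: mx_coefP => k; rewrite mx_coef_cst_row trmx0 if_same mx_coef0.
Qed.

Lemma rvec_delta d (x : 'cV[L]_d) : rvec (fun k => delta_mx 0 k) x = cst_row x.
Proof.
apply/rowP=> l; rewrite /rvec summxE (bigD1 l) //= big1 ?addr0 => [|k ne_kl].
  by rewrite [LHS]mxE [X in _ * X]mxE !eqxx mulr1 [RHS]mxE [x^T _ _]mxE.
by rewrite [LHS]mxE [X in _ * X]mxE [l == k]eq_sym (negPf ne_kl) andbF mulr0.
Qed.

(* T and B are the blocks of the matrix by which t acts on Ext^1, whose       *)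
(* quotient by the span of the b_i is Ga^d.                                   *)
Record presents d m (Phi : tmodule iota d) (Psi : tmodule iota 1)
    (b : 'I_m -> 'M[S]_(1, d)) (T : 'M[S]_m) (B : 'M[S]_(m, d)) : Prop := Presents {
  pres_inn0 : forall U, mx_coef (inn Phi Psi U) 0 = 0;
  pres_b0 : forall i, mx_coef (b i) 0 = 0;
  pres_surj : forall D, mx_coef D 0 = 0 ->
    exists z U, D = rvec b z + inn Phi Psi U;
  pres_inj : forall z U, rvec b z = inn Phi Psi U -> z = 0;
  pres_act : forall z x, exists U, Psi 'X *m (rvec b z + cst_row x) =
    rvec b (mx_eval T z + mx_eval B x) + cst_row (theta iota *: x) + inn Phi Psi U
}.

End ConstantRows.

Section ExtByAdditive.
Variables (F : finFieldType) (L : fieldType) (iota : {rmorphism {poly F} -> L}).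
Local Notation S := (twisted iota).
Variables (d m : nat) (Phi : tmodule iota d) (Psi : tmodule iota 1).
Variables (Theta : tmodule iota m) (b : 'I_m -> 'M[S]_(1, d)) (B : 'M[S]_(m, d)).

(** The zero block expresses that Ext^1_0 is stable under t; [B] is the contribution of C_t times a
    constant row to Ext^1_0. *)
Definition ext_mx : 'M[S]_(m + d) :=
  block_mx (Theta 'X) B 0 (tcst iota (theta iota))%:M.

Definition ext_basis (l : 'I_(m + d)) : 'M[S]_(1, d) :=
  match split l with inl i => b i | inr k => delta_mx 0 k end.

Hypothesis Theta0 : no_nilpotence Theta.
Hypothesis B0 : mx_coef B 0 = 0.

Fact ext_nilp : exists k, (mx_coef ext_mx 0 - (theta iota)%:M) ^+ k = 0.
Proof.
exists 1%N; rewrite expr1; apply/eqP; rewrite subr_eq0; apply/eqP.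
have -> : mx_coef ext_mx 0
        = block_mx (mx_coef (Theta 'X) 0) (mx_coef B 0) (mx_coef (0 : 'M[S]_(d, m)) 0)
            (mx_coef ((tcst iota (theta iota))%:M : 'M[S]_d) 0).
  by rewrite /mx_coef map_block_mx.
rewrite Theta0 B0 mx_coef0 [RHS]scalar_mx_block; congr block_mx.
apply/matrixP=> i j; rewrite !mxE; case: (i == j); last exact: skew_coef0.
by rewrite skew_coef_mon.
Qed.

Definition ext_tm : tmodule iota (m + d) := tmodule_of_mx ext_nilp.

Lemma ext_tmX : ext_tm 'X = ext_mx.
Proof. exact: tm_homX. Qed.

Lemma ext_basisl i : ext_basis (lshift d i) = b i.
Proof. by rewrite /ext_basis (unsplitK (inl i)). Qed.

Lemma ext_basisr k : ext_basis (rshift m k) = delta_mx 0 k.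
Proof. by rewrite /ext_basis (unsplitK (inr k)). Qed.

Lemma bc_ext_basis (K : fieldType) (j : {rmorphism L -> K}) z x :
  rvec (fun l => bc_mx j (ext_basis l)) (col_mx z x) =
  rvec (fun i => bc_mx j (b i)) z + cst_row (bc_iota iota j) x.
Proof.
have e1 : rvec (fun i => bc_mx j (ext_basis (lshift d i))) z
        = rvec (fun i => bc_mx j (b i)) z.
  by apply: eq_rvec => i; rewrite ext_basisl.
have e2 : rvec (fun k => bc_mx j (ext_basis (rshift m k))) x
        = cst_row (bc_iota iota j) x.
  transitivity (rvec (fun k => delta_mx 0 k : 'M[twisted (bc_iota iota j)]_(1, d)) x).
    by apply: eq_rvec => k; rewrite ext_basisr bc_delta_mx.
  exact: rvec_delta.
by rewrite [LHS]rvec_col_mx e1 e2.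
Qed.

Hypothesis pres : forall (K : fieldType) (j : {rmorphism L -> K}),
  presents (bc_tm j Phi) (bc_tm j Psi) (fun i => bc_mx j (b i))
    (bc_mx j (Theta 'X)) (bc_mx j B).

Lemma presents_Ext0 : Ext0_structure Phi Psi Theta b.
Proof.
move=> K j; have [in0 b0 surj inj act] := pres j.
apply: identifies_Der0 => // x; have [U eU] := act x 0; exists U.
by move: eU; rewrite scaler0 cst_row0 mx_eval0r !addr0 !bc_tmX.
Qed.

Lemma presents_Ext : Ext_structure Phi Psi ext_tm ext_basis.
Proof.
move=> K j; have [in0 b0 surj inj act] := pres j.
have rv0 z : mx_coef (rvec (fun i => bc_mx j (b i)) z) 0 = 0.
  by rewrite mx_coef_rvec big1 // => i _; rewrite b0 scaler0.
apply: identifies_Der => [y|y U|D].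
- rewrite -[y]vsubmxK; have [U eU] := act (usubmx y) (dsubmx y); exists U.
  rewrite bc_ext_basis [LHS]eU bc_tmX ext_tmX.
  suff -> : mx_eval (bc_mx j ext_mx) (col_mx (usubmx y) (dsubmx y)) =
    col_mx (mx_eval (bc_mx j (Theta 'X)) (usubmx y) + mx_eval (bc_mx j B) (dsubmx y))
      (theta (bc_iota iota j) *: dsubmx y) by rewrite bc_ext_basis.
  rewrite /bc_mx map_block_mx mx_eval_col !mx_eval_row map_mx0 mx_eval0l add0r.
  by rewrite map_scalar_mx /= bc_tw_tcst mx_eval_scalar.
- rewrite -[y]vsubmxK bc_ext_basis => eyU.
  (* Neither the [b i] nor inner biderivations have a constant term, so the constant term isolates
     the Ga^d coordinates of [y]. *)
  have /(congr1 (fun D => mx_coef D 0)) := eyU.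
  rewrite in0 mx_coefD rv0 add0r mx_coef_cst_row /= => /(congr1 trmx).
  rewrite trmxK trmx0 => y0; move: eyU; rewrite y0 cst_row0 addr0 => /inj->.
  by rewrite col_mx0.
- have [|z [U eD]] := surj (D - cst_row (bc_iota iota j) (mx_coef D 0)^T).
    by rewrite mx_coefB mx_coef_cst_row /= trmxK subrr.
  exists (col_mx z (mx_coef D 0)^T), U; rewrite bc_ext_basis addrAC -eD.
  by rewrite subrK.
Qed.

Lemma ext_inclusion :
  is_Ext0_to_Ext Phi Psi b ext_basis (col_mx 1%:M 0).
Proof.
move=> K j x; apply/(Der_inP (DerB (rep_Der _ _ _ _) (rep_Der _ _ _ _))).
exists 0; rewrite inn0 /= !repX /bc_mx map_col_mx map_mx1 map_mx0 mx_eval_col.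
by rewrite mx_eval1 mx_eval0l bc_ext_basis cst_row0 addr0 subrr.
Qed.

(** The two maps are the inclusion and the projection of coordinates, so exactness on K-points is
    that of K^m -> K^(m + d) -> K^d. *)
Lemma ext_exact :
  tm_short_exact Theta ext_tm (Ga iota d) (col_mx 1%:M 0) (row_mx 0 1%:M).
Proof.
split.
- rewrite /tm_morphism ext_tmX mul_col_mx mul_block_col.
  by rewrite mul1mx !mul0mx !mulmx1 !mulmx0 !addr0.
- rewrite /tm_morphism ext_tmX mul_mx_row mul_row_block.
  have -> : Ga iota d 'X = (tcst iota (theta iota))%:M by exact: tm_homX.
  by rewrite !mul0mx !mul1mx !mulmx0 mulmx1 !add0r.
move=> K j.
have fE x : mx_eval (bc_mx j (col_mx 1%:M 0 : 'M[S]_(m + d, m))) x = col_mx x 0.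
  by rewrite /bc_mx map_col_mx map_mx1 map_mx0 mx_eval_col mx_eval1 mx_eval0l.
have gE y : mx_eval (bc_mx j (row_mx 0 1%:M : 'M[S]_(d, m + d))) y = dsubmx y.
  rewrite -[y in LHS]vsubmxK /bc_mx map_row_mx map_mx1 map_mx0 mx_eval_row.
  by rewrite mx_eval1 mx_eval0l add0r.
split=> [x|y|z].
- by rewrite fE -col_mx0 => /eq_col_mx[].
- rewrite gE; split=> [y0|[x ->]]; last by rewrite fE col_mxKd.
  by exists (usubmx y); rewrite fE -y0 vsubmxK.
- by exists (col_mx 0 z); rewrite gE col_mxKd.
Qed.

End ExtByAdditive.

(* I shifts leading coordinates by n, so it is injective and the coordinates  *)
(* below n describe its cokernel.                                             *)
Section Triangular.
Variables (V : zmodType) (L : fieldType) (d n : nat).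
Variables (c : nat -> V -> 'rV[L]_d) (I : V -> V) (P : nat -> 'M[L]_d).
Hypothesis cB : forall w x y, c w (x - y) = c w x - c w y.
Hypothesis c_fin : forall x, exists N, forall w, (N <= w)%N -> c w x = 0.
Hypothesis c_inj : forall x, (forall w, c w x = 0) -> x = 0.
Hypothesis c_mon : forall w v,
  exists x, c w x = v /\ forall w', (w < w')%N -> c w' x = 0.
Hypothesis ID : forall x y, I (x + y) = I x + I y.
Hypothesis I_lead : forall w x, (forall w', (w < w')%N -> c w' x = 0) ->
  c (w + n) (I x) = c w x *m P w.
Hypothesis P_unit : forall w, P w \in unitmx.

(** The highest non-zero coordinate w of [x] would reappear, multiplied by the invertible [P w], as
    coordinate w + n of [I x]. The induction is on the distance from w to a bound beyond which [x]
    vanishes. *)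
Lemma triangular_inj x : (forall w, (n <= w)%N -> c w (I x) = 0) -> x = 0.
Proof.
move=> Ix0; have [N cN] := c_fin x; apply: c_inj => w.
have [k le_k] : exists k, (N - w <= k)%N by exists (N - w)%N.
elim: k w le_k => [|k IH] w le_k.
  by apply: cN; rewrite -subn_eq0 -leqn0.
have lead : c (w + n) (I x) = c w x *m P w.
  apply: I_lead => w' lt_ww'; apply: IH; rewrite leq_subLR.
  by rewrite leq_subLR addnS -addSn in le_k; rewrite (leq_trans le_k) // leq_add2r.
by rewrite -[LHS](mulmxK (P_unit w)) -lead Ix0 ?mul0mx // leq_addl.
Qed.

(** Division with remainder: the top coordinate N + n of [y] is removed by [I u], where [u] has top
    coordinate N, equal to that of [y] times the inverse of [P N]. *)
Lemma triangular_surj y : exists x, forall w, (n <= w)%N -> c w (y - I x) = 0.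
Proof.
have [N cN] := c_fin y.
have {cN} : forall w, (n + N <= w)%N -> c w y = 0.
  by move=> w le_w; apply: cN; apply: leq_trans le_w; apply: leq_addl.
elim: N y => [|N IH] y cy.
  exists 0; have -> : I 0 = 0 by apply: (addrI (I 0)); rewrite -ID !addr0.
  by move=> w le_w; rewrite subr0 cy ?addn0.
have [u [cu u0]] := c_mon N (c (N + n) y *m invmx (P N)).
have [x cx] : exists x, forall w, (n <= w)%N -> c w (y - I u - I x) = 0.
  apply: IH => w; rewrite addnC leq_eqVlt => /predU1P[<-|lt_w].
    by rewrite cB (I_lead u0) cu mulmxKV ?subrr.
  rewrite cB cy ?sub0r; last by rewrite addnS addnC.
  have -> : w = (w - n + n)%N by rewrite subnK // (leq_trans (leq_addl N n)) // ltnW.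
  have lt_Nw : (N < w - n)%N by rewrite ltn_subRL addnC.
  rewrite I_lead ?u0 ?mul0mx ?oppr0 // => w' lt_ww'.
  by rewrite u0 // (ltn_trans lt_Nw).
exists (u + x) => w le_w.
by rewrite ID opprD addrA cx.
Qed.

End Triangular.

(** * Block decomposition of matrices with p * d rows or columns *)

Section Blocks.
Variable p d : nat.

Definition mxvec_pair (a : 'I_(p * d)) : 'I_p * 'I_d :=
  enum_val (cast_ord (esym (mxvec_cast p d)) a).

Lemma mxvec_indexK i k : mxvec_pair (mxvec_index i k) = (i, k).
Proof. by rewrite /mxvec_pair /mxvec_index cast_ordK enum_rankK. Qed.

Lemma big_mxvec_index (V : nmodType) (f : 'I_(p * d) -> V) :
  \sum_a f a = \sum_i \sum_k f (mxvec_index i k).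
Proof.
rewrite pair_bigA (reindex _ (curry_mxvec_bij p d)) /=.
by apply: eq_bigr => -[].
Qed.

Lemma mxvec_index_inj i k i' k' :
  (mxvec_index i k == mxvec_index i' k' :> 'I_(p * d)) = (i == i') && (k == k').
Proof.
apply/eqP/andP=> [/(congr1 mxvec_pair)|[/eqP-> /eqP->] //].
by rewrite !mxvec_indexK => -[-> ->].
Qed.

Variable R : comNzRingType.

Definition rblock n (A : 'M[R]_(p * d, n)) i := rowsub (@mxvec_index p d i) A.
Definition cblock m (A : 'M[R]_(m, p * d)) i := colsub (@mxvec_index p d i) A.

Lemma mulmx_blocks m n (A : 'M[R]_(m, p * d)) (B : 'M[R]_(p * d, n)) :
  A *m B = \sum_i cblock A i *m rblock B i.
Proof.
apply/matrixP=> u v; rewrite mxE big_mxvec_index summxE; apply: eq_bigr => i _.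
by rewrite mxE; apply: eq_bigr => k _; rewrite !mxE.
Qed.

Lemma rblock_mul m n (A : 'M[R]_(p * d, m)) (B : 'M[R]_(m, n)) i :
  rblock (A *m B) i = rblock A i *m B.
Proof. by rewrite /rblock mul_rowsub_mx. Qed.

Lemma cblock_mul m n (A : 'M[R]_(n, m)) (B : 'M[R]_(m, p * d)) i :
  cblock (A *m B) i = A *m cblock B i.
Proof. by rewrite /cblock mulmx_colsub. Qed.

Lemma rblockP n (A B : 'M[R]_(p * d, n)) :
  (forall i, rblock A i = rblock B i) -> A = B.
Proof.
move=> eqAB; apply/matrixP=> a v; case/mxvec_indexP: a => i k.
by have /matrixP/(_ k v) := eqAB i; rewrite !mxE.
Qed.

Lemma cblockP m (A B : 'M[R]_(m, p * d)) :
  (forall i, cblock A i = cblock B i) -> A = B.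
Proof.
move=> eqAB; apply/matrixP=> u a; case/mxvec_indexP: a => i k.
by have /matrixP/(_ u k) := eqAB i; rewrite !mxE.
Qed.

Lemma rblockD n (A B : 'M[R]_(p * d, n)) i : rblock (A + B) i = rblock A i + rblock B i.
Proof. by apply/matrixP=> u v; rewrite !mxE. Qed.

Lemma rblockZ n c (A : 'M[R]_(p * d, n)) i : rblock (c *: A) i = c *: rblock A i.
Proof. by apply/matrixP=> u v; rewrite !mxE. Qed.

Lemma cblock0 m i : cblock (0 : 'M[R]_(m, p * d)) i = 0.
Proof. by apply/matrixP=> u v; rewrite !mxE. Qed.

Lemma cblockB m (A B : 'M[R]_(m, p * d)) i : cblock (A - B) i = cblock A i - cblock B i.
Proof. by apply/matrixP=> u v; rewrite !mxE. Qed.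

Lemma cblockD m (A B : 'M[R]_(m, p * d)) i : cblock (A + B) i = cblock A i + cblock B i.
Proof. by apply/matrixP=> u v; rewrite !mxE. Qed.

Lemma cblockZ n c (A : 'M[R]_(n, p * d)) i : cblock (c *: A) i = c *: cblock A i.
Proof. by apply/matrixP=> u v; rewrite !mxE. Qed.

Definition mx_blocks (G : 'I_p -> 'I_p -> 'M[R]_d) : 'M[R]_(p * d) :=
  \matrix_(a, b) G (mxvec_pair a).1 (mxvec_pair b).1 (mxvec_pair a).2 (mxvec_pair b).2.

Definition row_blocks m (G : 'I_p -> 'M[R]_(m, d)) : 'M[R]_(m, p * d) :=
  \matrix_(u, b) G (mxvec_pair b).1 u (mxvec_pair b).2.

Definition col_blocks n (G : 'I_p -> 'M[R]_(d, n)) : 'M[R]_(p * d, n) :=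
  \matrix_(a, v) G (mxvec_pair a).1 (mxvec_pair a).2 v.

Lemma cblock_row_blocks m (G : 'I_p -> 'M[R]_(m, d)) i : cblock (row_blocks G) i = G i.
Proof. by apply/matrixP=> u v; rewrite !mxE mxvec_indexK. Qed.

Lemma rblock_col_blocks n (G : 'I_p -> 'M[R]_(d, n)) i : rblock (col_blocks G) i = G i.
Proof. by apply/matrixP=> u v; rewrite !mxE mxvec_indexK. Qed.

Lemma row_blocks_mul m n (G : 'I_p -> 'M[R]_(m, d)) (z : 'M_(_, n)) :
  row_blocks G *m z = \sum_i G i *m rblock z i.
Proof. by rewrite mulmx_blocks; apply: eq_bigr => i _; rewrite cblock_row_blocks. Qed.

Lemma rblock_mx_blocks_mul n G (z : 'M_(_, n)) i :
  rblock (mx_blocks G *m z) i = \sum_j G i j *m rblock z j.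
Proof.
rewrite rblock_mul mulmx_blocks; apply: eq_bigr => j _; congr (_ *m _).
by apply/matrixP=> u v; rewrite !mxE !mxvec_indexK.
Qed.

Lemma cblock_mul_mx_blocks m G (v : 'M_(m, _)) j :
  cblock (v *m mx_blocks G) j = \sum_i cblock v i *m G i j.
Proof.
rewrite cblock_mul mulmx_blocks; apply: eq_bigr => i _; congr (_ *m _).
by apply/matrixP=> u k; rewrite !mxE !mxvec_indexK.
Qed.

End Blocks.

(** * Inner biderivations with values in the Carlitz module *)

Section CarlitzTarget.
Variables (F : finFieldType) (L : fieldType) (iota : {rmorphism {poly F} -> L}).
Local Notation S := (twisted iota).
Local Notation theta := (theta iota).

Lemma frobm_mx0 i m n : frobm iota i (0 : 'M[L]_(m, n)) = 0.
Proof. exact: map_mx0. Qed.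

Lemma frobmD i m n (A B : 'M[L]_(m, n)) :
  frobm iota i (A + B) = frobm iota i A + frobm iota i B.
Proof. exact: map_mxD. Qed.

Lemma frobm_sum i m n I (r : seq I) (P : pred I) (A : I -> 'M[L]_(m, n)) :
  frobm iota i (\sum_(k <- r | P k) A k) = \sum_(k <- r | P k) frobm iota i (A k).
Proof. exact: raddf_sum. Qed.

Lemma frobmM i m n r (A : 'M[L]_(m, n)) (B : 'M[L]_(n, r)) :
  frobm iota i (A *m B) = frobm iota i A *m frobm iota i B.
Proof. exact: map_mxM. Qed.

Lemma frobm_unit i n (A : 'M[L]_n) : A \in unitmx -> frobm iota i A \in unitmx.
Proof. by rewrite map_unitmx. Qed.

Lemma frobm_tr i m n (A : 'M[L]_(m, n)) : frobm iota i A^T = (frobm iota i A)^T.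
Proof. by rewrite /frobm map_trmx. Qed.

Lemma frobm_rblock i p d n (A : 'M[L]_(p * d, n)) (k : 'I_p) :
  frobm iota i (rblock A k) = rblock (frobm iota i A) k.
Proof. by apply/matrixP=> u v; rewrite !mxE. Qed.

Lemma frobm_cblock i p d n (A : 'M[L]_(n, p * d)) (k : 'I_p) :
  frobm iota i (cblock A k) = cblock (frobm iota i A) k.
Proof. by apply/matrixP=> u v; rewrite !mxE. Qed.

Lemma frobm_scalar i m c : frobm iota i (c%:M : 'M[L]_m) = (frobi iota i c)%:M.
Proof. exact: map_scalar_mx. Qed.

Lemma frobm_mx_blocks i p d (G : 'I_p -> 'I_p -> 'M[L]_d) :
  frobm iota i (mx_blocks G) = mx_blocks (fun a b => frobm iota i (G a b)).
Proof. by apply/matrixP=> u v; rewrite !mxE. Qed.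

Variables (d : nat) (Phi : tmodule iota d) (Psi : tmodule iota 1).
(** Only the matrix of [Psi] is prescribed, so that the section applies to the base change of
    [Carlitz] along any L -> K. *)
Hypothesis PsiX : Psi 'X = (tcst iota theta + tau iota)%:M.
Hypothesis Phi0 : no_nilpotence Phi.

Lemma mx_coef_Carlitz_mul (D : 'M[S]_(1, d)) k :
  mx_coef (Psi 'X *m D) k =
  theta *: mx_coef D k + if k is k'.+1 then frobm iota 1 (mx_coef D k') else 0.
Proof.
by rewrite PsiX mul_scalar_mx scalerDl mx_coefD mx_coef_tcstZ mx_coef_tauZ.
Qed.

Lemma mx_coef_inn U k :
  mx_coef (inn Phi Psi U) k =
  \sum_(i < k.+1) mx_coef U i *m frobm iota i (mx_coef (Phi 'X) (k - i))
  - (theta *: mx_coef U k + if k is k'.+1 then frobm iota 1 (mx_coef U k') else 0).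
Proof. by rewrite inn.unlock mx_coefB mx_coefM mx_coef_Carlitz_mul. Qed.

(** Both U Phi_t and C_t U have constant term theta U_0, since the constant term of Phi_t is
    scalar. *)
Lemma inn_const0 U : mx_coef (inn Phi Psi U) 0 = 0.
Proof.
rewrite mx_coef_inn big_ord1 Phi0 frobm0 mul_mx_scalar addr0.
by rewrite subrr.
Qed.

(** In both presentations, C_t times a normal form is brought back to normal form by subtracting
    [inn] of a constant row. *)
Lemma mx_coef_inn_cst (x : 'cV[L]_d) k :
  mx_coef (inn Phi Psi (cst_row iota x)) k.+1 =
  x^T *m mx_coef (Phi 'X) k.+1 - (if k == 0%N then frobm iota 1 x^T else 0).
Proof.
rewrite mx_coef_inn !mx_coef_cst_row /= scaler0 add0r; congr (_ - _).
  rewrite big_ord_recl mx_coef_cst_row frobm0 big1 ?addr0 // => i _.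
  by rewrite mx_coef_cst_row mul0mx.
by case: k => [|k]; rewrite ?frobm_mx0.
Qed.

(** The map [inn] is not L-linear: the tau in C_t turns c into c^q when moved past it. The extra
    terms are this defect. *)
Lemma inn_tcstZ (c : L) (U : 'M[S]_(1, d)) :
  inn Phi Psi (tcst iota c *: U) =
  tcst iota c *: inn Phi Psi U
  + (tcst iota c *: (tau iota *: U) - tcst iota (frob iota c) *: (tau iota *: U)).
Proof.
rewrite !inn.unlock PsiX !mul_scalar_mx -scalemxAl scalerBr -!addrA.
congr (_ + _); rewrite !scalerA mulrDl mulrDr -!tcstM [c * _]mulrC tau_tcst !scalerDl.
have abel (V : zmodType) (x y z : V) : - (x + z) = - (x + y) + (y - z).
  by rewrite !opprD -addrA addKr.
exact: abel.
Qed.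

End CarlitzTarget.

(** * The dual t-module *)

Section DualBasis.
Variables (F : finFieldType) (L : fieldType) (iota : {rmorphism {poly F} -> L}).
Local Notation S := (twisted iota).
Variables (n d : nat).

Lemma mx_coef_dual_rvec (z : 'cV[L]_(n.-1 * d)) k :
  mx_coef (rvec (dual_basis iota n d) z) k =
  \sum_(i < n.-1) (if k == i.+1 then (rblock z i)^T else 0).
Proof.
rewrite mx_coef_rvec; apply/rowP=> c; rewrite !summxE big_mxvec_index.
apply: eq_bigr => i _; rewrite (bigD1 c) //= big1 ?addr0 => [|e ne_ec].
  rewrite [LHS]mxE [X in _ * X]mxE [dual_basis _ _ _ _ _ _]mxE.
  rewrite skew_coef_sum (bigD1 i) ?eqxx //= big1 ?addr0 => [|i'].
    by rewrite skew_coef_tauX; case: eqP => _; rewrite ?mulr1 ?mulr0 !mxE.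
  by rewrite mxvec_index_inj eqxx andbT eq_sym => /andP[/eqP->]; rewrite eqxx.
rewrite [LHS]mxE [X in _ * X]mxE [dual_basis _ _ _ _ _ _]mxE.
rewrite big_pred0 ?skew_coef0 ?mulr0 // => i'.
by rewrite mxvec_index_inj (negPf ne_ec) andbF.
Qed.

Lemma dual_basis_coef0 i : mx_coef (dual_basis iota n d i) 0 = 0.
Proof.
apply/rowP=> c; rewrite [LHS]mxE [dual_basis _ _ _ _ _ _]mxE skew_coef_sum mxE.
by rewrite big1 // => k _; rewrite skew_coef_tauX.
Qed.

Lemma bc_dual_basis (K : fieldType) (j : {rmorphism L -> K}) l :
  bc_mx j (dual_basis iota n d l) = dual_basis (bc_iota iota j) n d l.
Proof.
apply/rowP=> c; rewrite [LHS]mxE ![dual_basis _ _ _ _ _ _]mxE rmorph_sum.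
by apply: eq_bigr => i _; rewrite rmorphXn /= bc_tw_tau.
Qed.

End DualBasis.

Section DualPresentation.
Variables (F : finFieldType) (L : fieldType) (iota : {rmorphism {poly F} -> L}).
Local Notation S := (twisted iota).
Local Notation theta := (theta iota).
Variables (d q : nat).
Local Notation p := q.+1.
Local Notation n := q.+2.

(** Block i holds the coefficient of degree i + 1, transposed. The identities below the diagonal are
    multiplication by tau. Its overflow v tau^n, where v is the Frobenius twist of the last block,
    is cancelled by subtracting [inn] of the constant row v M_n^-1. This adds - v M_n^-1 M_(i+1) in
    degree i + 1, which is the last column here, and the twist of v M_n^-1 in degree 1, which is
    [dual_coef2]. *)
Definition dual_coef1 (M : nat -> 'M[L]_d) : 'M[L]_(p * d) :=
  mx_blocks (fun i j : 'I_p => (if i == j.+1 :> nat then 1%:M else 0)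
     - (if j == ord_max then (invmx (M n) *m M i.+1)^T else 0)).

Definition dual_coef2 (M : nat -> 'M[L]_d) : 'M[L]_(p * d) :=
  mx_blocks (fun i j : 'I_p => if (i == ord0) && (j == ord_max)
     then (frobm iota 1 (invmx (M n)))^T else 0).

Definition dual_mx (M : nat -> 'M[L]_d) : 'M[S]_(p * d) :=
  mx_tw iota 3 (fun k => match k with
    | 0 => theta%:M | 1 => dual_coef1 M | _ => dual_coef2 M end).

(** C_t times a constant row x has the term x^(1) tau, already in normal form because n >= 2. *)
Definition dual_ext_mx : 'M[S]_(p * d, d) :=
  mx_tw iota 2 (fun k => if k == 1%N
    then col_blocks (fun i : 'I_p => if i == ord0 then 1%:M else 0) else 0).

Lemma rblock_eval_dual M (z : 'cV[L]_(p * d)) i :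
  rblock (mx_eval (dual_mx M) z) i =
  theta *: rblock z i
  + (\sum_(j < p) (if i == j.+1 :> nat then frobm iota 1 (rblock z j) else 0)
     - (invmx (M n) *m M i.+1)^T *m frobm iota 1 (rblock z ord_max))
  + (if i == ord0 then (frobm iota 1 (invmx (M n)))^T *m frobm iota 2 (rblock z ord_max)
     else 0).
Proof.
have -> : mx_eval (dual_mx M) z =
    theta%:M *m frobm iota 0 z + dual_coef1 M *m frobm iota 1 z
    + dual_coef2 M *m frobm iota 2 z.
  rewrite (@mx_evalE _ _ _ 3) => [|k le_k]; last by rewrite mx_coef_tw ltnNge le_k.
  by rewrite !big_ord_recl big_ord0 !mx_coef_tw /= addr0 addrA.
rewrite !rblockD frobm0 mul_scalar_mx rblockZ; congr (_ + _ + _).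
  rewrite rblock_mx_blocks_mul.
  under eq_bigr do rewrite /= mulmxBl.
  rewrite sumrB; congr (_ - _).
    by apply: eq_bigr => j _; case: ifP => _; rewrite ?mul1mx ?mul0mx ?frobm_rblock.
  rewrite (bigD1 ord_max) //= eqxx frobm_rblock big1 ?addr0 // => j /negPf->.
  by rewrite mul0mx.
rewrite rblock_mx_blocks_mul; case: eqP => _ /=; last first.
  by rewrite big1 // => j _; rewrite mul0mx.
rewrite (bigD1 ord_max) //= eqxx big1 ?addr0 => [|j /negPf->]; last by rewrite mul0mx.
by rewrite frobm_rblock.
Qed.

Lemma rblock_eval_dual_ext (x : 'cV[L]_d) i :
  rblock (mx_eval dual_ext_mx x) i = if i == ord0 then frobm iota 1 x else 0.
Proof.
rewrite (@mx_evalE _ _ _ 2) => [|k le_k]; last by rewrite mx_coef_tw ltnNge le_k.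
rewrite !big_ord_recl big_ord0 !mx_coef_tw /= addr0 mul0mx add0r.
by rewrite rblock_mul rblock_col_blocks; case: ifP; rewrite ?mul1mx ?mul0mx.
Qed.

Variables (Phi : tmodule iota d) (Psi : tmodule iota 1).
Local Notation M := (fun k => mx_coef (Phi 'X) k).
Hypothesis PsiX : Psi 'X = (tcst iota theta + tau iota)%:M.
Hypothesis Phi0 : no_nilpotence Phi.
Hypothesis Mn_unit : mx_coef (Phi 'X) n \in unitmx.
Hypothesis M_big : forall k, (n < k)%N -> mx_coef (Phi 'X) k = 0.

(** C_t U stops at degree w + 1 < w + n, and in U Phi_t only the product of the two leading terms
    reaches degree w + n. *)
Lemma mx_coef_inn_lead w (U : 'M[S]_(1, d)) :
  (forall w', (w < w')%N -> mx_coef U w' = 0) ->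
  mx_coef (inn Phi Psi U) (w + n) = mx_coef U w *m frobm iota w (mx_coef (Phi 'X) n).
Proof.
move=> U0; rewrite (mx_coef_inn Phi PsiX) addnS U0 ?ltnS ?leq_addr // scaler0 add0r.
rewrite U0 ?addnS ?ltnS ?leq_addr // frobm_mx0 subr0.
have lt_w : (w < (w + q).+3)%N by rewrite ltnS -!addnS leq_addr.
rewrite (bigD1 (Ordinal lt_w)) //= big1 ?addr0 => [|i ne_iw].
  by congr (_ *m frobm _ _ (mx_coef _ _)); rewrite -!addnS addKn.
have [lt_iw|lt_wi|eq_iw] := ltngtP i w; last by rewrite -val_eqE /= eq_iw eqxx in ne_iw.
  rewrite M_big ?frobm_mx0 ?mulmx0 // ltn_subRL.
  by rewrite !addnS !ltnS ltn_add2r.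
by rewrite U0 // mul0mx.
Qed.

Lemma row_monomial w (v : 'rV[L]_d) : exists x : 'M[S]_(1, d),
  mx_coef x w = v /\ forall w', (w < w')%N -> mx_coef x w' = 0.
Proof.
exists (mx_tw iota w.+1 (fun k => if k == w then v else 0)); split=> [|w' lt_w].
  by rewrite mx_coef_tw ltnSn eqxx.
by rewrite mx_coef_tw ltnS leqNgt lt_w.
Qed.

Lemma mx_coef_fin (x : 'M[S]_(1, d)) :
  exists N, forall w, (N <= w)%N -> mx_coef x w = 0.
Proof. by exists (mx_deg x).+1 => w; apply: mx_coef_deg. Qed.

Lemma inn_big_inj (U : 'M[S]_(1, d)) :
  (forall k, (n <= k)%N -> mx_coef (inn Phi Psi U) k = 0) -> U = 0.
Proof.
apply: (@triangular_inj _ _ d n (fun k x => mx_coef x k) _ _ mx_coef_fin _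
  (@mx_coef_inn_lead)) => [x x0|w].
  by apply: mx_coefP => k; rewrite x0 mx_coef0.
exact: frobm_unit.
Qed.

Lemma inn_reduce (D : 'M[S]_(1, d)) :
  exists U, forall k, (n <= k)%N -> mx_coef (D - inn Phi Psi U) k = 0.
Proof.
apply: (@triangular_surj _ _ d n (fun k x => mx_coef x k) _ _ _ mx_coef_fin row_monomial
  _ (@mx_coef_inn_lead)) => [w x y|x y|w]; first exact: mx_coefB.
- exact: innD.
- exact: frobm_unit.
Qed.

Lemma dual_rvec_big (z : 'cV[L]_(n.-1 * d)) k : (n <= k)%N ->
  mx_coef (rvec (dual_basis iota n d) z) k = 0.
Proof.
move=> le_nk; rewrite mx_coef_dual_rvec big1 // => i _; rewrite gtn_eqF //.
by apply: leq_trans le_nk; rewrite ltnS.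
Qed.

Lemma dual_rvec_coef (z : 'cV[L]_(n.-1 * d)) (i : 'I_p) :
  mx_coef (rvec (dual_basis iota n d) z) i.+1 = (rblock z i)^T.
Proof.
rewrite mx_coef_dual_rvec (bigD1 i) //= eqxx big1 ?addr0 // => i' ne_ii'.
by rewrite eqSS -[_ == _]/(i == i') eq_sym (negPf ne_ii').
Qed.

Lemma dual_rvec_coef0 (z : 'cV[L]_(n.-1 * d)) :
  mx_coef (rvec (dual_basis iota n d) z) 0 = 0.
Proof. by rewrite mx_coef_dual_rvec big1. Qed.

Lemma dual_rvec_of_coef (D : 'M[S]_(1, d)) :
  mx_coef D 0 = 0 -> (forall k, (n <= k)%N -> mx_coef D k = 0) ->
  D = rvec (dual_basis iota n d)
        (col_blocks (fun i : 'I_p => (mx_coef D i.+1)^T)).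
Proof.
move=> D0 Dbig; apply: mx_coefP => -[|k]; first by rewrite dual_rvec_coef0.
have [lt_kp|le_pk] := ltnP k p; last by rewrite Dbig // dual_rvec_big.
by rewrite (dual_rvec_coef _ (Ordinal lt_kp)) rblock_col_blocks trmxK.
Qed.

Lemma dual_presents :
  presents Phi Psi (dual_basis iota n d) (dual_mx M) dual_ext_mx.
Proof.
split.
- exact: inn_const0.
- exact: dual_basis_coef0.
- move=> D D0; have [U DU0] := inn_reduce D.
  have DU00 : mx_coef (D - inn Phi Psi U) 0 = 0.
    by rewrite mx_coefB D0 (inn_const0 PsiX Phi0) subrr.
  exists (col_blocks (fun i : 'I_p => (mx_coef (D - inn Phi Psi U) i.+1)^T)), U.
  by rewrite -(dual_rvec_of_coef DU00 DU0) subrK.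
- move=> z U ezU; have U0 : U = 0.
    by apply: inn_big_inj => k le_k; rewrite -ezU dual_rvec_big.
  apply: rblockP => i; apply: trmx_inj; rewrite -dual_rvec_coef ezU U0 inn0 mx_coef0.
  by apply/matrixP=> u v; rewrite !mxE.
move=> z x.
(* The constant row whose [inn] has the same tau^n term as C_t times the normal form of [z]. *)
pose u := (frobm iota 1 (rblock z ord_max)^T *m invmx (mx_coef (Phi 'X) n))^T.
exists (cst_row iota u); apply: mx_coefP => k.
rewrite (mx_coef_Carlitz_mul PsiX) !mx_coefD !mx_coef_cst_row.
case: k => [|k].
  by rewrite !dual_rvec_coef0 (inn_const0 PsiX Phi0) !addr0 !add0r linearZ.
rewrite (mx_coef_inn_cst Phi PsiX) /= !addr0 trmxK.
have [lt_kp|le_pk] := ltnP k p.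
  pose i := Ordinal lt_kp; rewrite -[k]/(i : nat) !dual_rvec_coef.
  rewrite rblockD rblock_eval_dual rblock_eval_dual_ext.
  rewrite mx_coefD mx_coef_cst_row (@mx_coef_dual_rvec _ _ _ n d z) frobmD frobm_sum.
  have abel (V : zmodType) (a s y b c : V) :
      a + (s + y) = a + (s - b) + c + y + (b - c).
    rewrite -!addrA; congr (_ + (_ + _)).
    by rewrite (addrCA y b) (addrCA c b) addKr (addrCA c y) subrr addr0.
  have e1 : (\sum_(j < p) (if k == j.+1 then frobm iota 1 (rblock z j) else 0))^T
      = \sum_(j < p) frobm iota 1 (if k == j.+1 then (rblock z j)^T else 0).
    rewrite raddf_sum; apply: eq_bigr => j _ /=.
    by case: ifP => _; rewrite ?frobm_tr // trmx0 frobm_mx0.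
  have e2 : (if i == ord0 then (frobm iota 1 (invmx (mx_coef (Phi 'X) n)))^T
          *m frobm iota 2 (rblock z ord_max) else 0)^T
      = if i == ord0 then (frobm iota 2 (rblock z ord_max))^T
          *m frobm iota 1 (invmx (mx_coef (Phi 'X) n)) else 0.
    by case: ifP => _; rewrite ?trmx0 // trmx_mul trmxK.
  have e3 : (if i == ord0 then frobm iota 1 x else 0)^T
      = frobm iota 1 (if i == ord0 then x^T else 0).
    by case: ifP => _; rewrite ?frobm_tr // trmx0 frobm_mx0.
  rewrite 3!linearD linearB linearZ /= trmx_mul trmxK e1 e2 e3.
  rewrite -[k == 0%N]/(i == ord0) frobmM !frobm_tr frobm_add mulmxA.
  exact: abel.
rewrite !dual_rvec_big // scaler0 !add0r.
(* The coefficient considered is that of degree k + 1; at k = p this is degree n, where the overflow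
   must cancel. *)
have [->|ne_kp] := eqVneq k p.
  rewrite subr0 mulmxKV //= mx_coefD mx_coef_cst_row /= addr0.
  by rewrite (@dual_rvec_coef z ord_max) frobm_tr.
have lt_pk : (p < k)%N by rewrite ltn_neqAle eq_sym ne_kp.
rewrite (M_big (lt_pk : (n < k.+1)%N)) mulmx0 gtn_eqF ?(leq_trans _ le_pk) // subr0.
rewrite mx_coefD mx_coef_cst_row gtn_eqF ?(leq_trans _ le_pk) // addr0.
by rewrite dual_rvec_big ?frobm_mx0.
Qed.

End DualPresentation.

(** * The bidual *)

Section BidualPresentation.
Variables (F : finFieldType) (L : fieldType) (iota : {rmorphism {poly F} -> L}).
Local Notation S := (twisted iota).
Local Notation theta := (theta iota).
Variables (d q : nat).
Local Notation p := q.+1.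
Local Notation n := q.+2.

(** The factor M_n^-T is a choice of coordinates on the last block: with it t acts by Phi_t itself,
    not by a conjugate. *)
Definition bidual_coef (M : nat -> 'M[L]_d) : 'M[L]_(d, p * d) :=
  row_blocks (fun j : 'I_p => if j == ord_max then (invmx (M n))^T else 0).

Definition bidual_basis (M : nat -> 'M[L]_d) (k : 'I_d) : 'M[S]_(1, p * d) :=
  mx_tw iota 2 (fun e => if e == 1%N then row k (bidual_coef M) else 0).

(** Block i of a constant row enters the correction [bidual_corr] of index m = i + k twisted by
    tau^k, and that correction is multiplied by M_(m+1). *)
Definition bidual_ext_mx (M : nat -> 'M[L]_d) : 'M[S]_(d, p * d) :=
  mx_tw iota n (fun k => if k == 0%N then 0 else row_blocks (fun i : 'I_p => M (i + k).+1)).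

Lemma mx_coef_bidual_rvec M z k :
  mx_coef (rvec (bidual_basis M) z) k = if k == 1%N then z^T *m bidual_coef M else 0.
Proof.
rewrite mx_coef_rvec; case: eqP => [->|/eqP/negPf ne_k1].
  rewrite mulmx_sum_row; apply: eq_bigr => i _.
  by rewrite mx_coef_tw mxE.
by rewrite big1 // => i _; rewrite mx_coef_tw ne_k1 if_same scaler0.
Qed.

Lemma cblock_mul_dual1 M (v : 'rV[L]_(p * d)) e j :
  cblock (v *m frobm iota e (dual_coef1 q M)) j =
  \sum_(i < p) (if i == j.+1 :> nat then cblock v i else 0)
  - (if j == ord_max
     then \sum_(i < p) cblock v i *m frobm iota e (invmx (M n) *m M i.+1)^T else 0).
Proof.
rewrite frobm_mx_blocks cblock_mul_mx_blocks.
under eq_bigr do rewrite /frobm map_mxB mulmxBr.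
rewrite sumrB; congr (_ - _).
  apply: eq_bigr => i _; case: ifP => _; last by rewrite map_mx0 mulmx0.
  by rewrite map_mx1 mulmx1.
case: eqP => _; first by [].
by rewrite big1 // => i _; rewrite map_mx0 mulmx0.
Qed.

Lemma cblock_mul_dual2 M (v : 'rV[L]_(p * d)) e j :
  cblock (v *m frobm iota e (dual_coef2 iota q M)) j =
  if j == ord_max then cblock v ord0 *m frobm iota e (frobm iota 1 (invmx (M n)))^T
  else 0.
Proof.
rewrite frobm_mx_blocks cblock_mul_mx_blocks (bigD1 ord0) //= big1 ?addr0 => [|i].
  by case: eqP => _; rewrite ?frobm_mx0 ?mulmx0.
by move=> /negPf->; rewrite frobm_mx0 mulmx0.
Qed.

Variables (Phi : tmodule iota d) (Phiv : tmodule iota (p * d)) (Psi : tmodule iota 1).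
Local Notation M := (fun k => mx_coef (Phi 'X) k).
Hypothesis PsiX : Psi 'X = (tcst iota theta + tau iota)%:M.
Hypothesis Phi0 : no_nilpotence Phi.
Hypothesis Mn_unit : mx_coef (Phi 'X) n \in unitmx.
Hypothesis M_big : forall k, (n < k)%N -> mx_coef (Phi 'X) k = 0.
Hypothesis PhivX : Phiv 'X = dual_mx iota q M.

Lemma mx_coef_inn_dual U k :
  mx_coef (inn Phiv Psi U) k.+1 =
  mx_coef U k.+1 *m frobm iota k.+1 theta%:M
  + mx_coef U k *m frobm iota k (dual_coef1 q M)
  + (if k is k'.+1 then mx_coef U k' *m frobm iota k' (dual_coef2 iota q M) else 0)
  - (theta *: mx_coef U k.+1 + frobm iota 1 (mx_coef U k)).
Proof.
rewrite (mx_coef_inn Phiv PsiX) PhivX; congr (_ - _).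
rewrite 2!big_ord_recr /= subnn subSnn !mx_coef_tw /=.
rewrite [LHS]addrC [X in _ + X = _]addrC [LHS]addrA; congr (_ + _).
case: k => [|k]; first by rewrite big_ord0.
rewrite big_ord_recr /= big1 ?add0r => [|i _].
  by rewrite !subSn // subnn mx_coef_tw.
rewrite mx_coef_tw ltnNge -[(2 < _)%N]/(3 <= _)%N leq_subRL; last first.
  by rewrite (leq_trans (ltnW (ltn_ord i))) // !leqW.
by rewrite addnC addSn addSn addSn ltnS !ltnS ltn_ord /= frobm_mx0 mulmx0.
Qed.

(* The w-th block coordinate: blocks are ordered by degree first, and inside  *)
(* a degree from the last block to the first.  For this order the leading     *)
(* term of [inn Phiv Psi] is a shift by n, as it is for [inn Phi Psi].        *)
Definition bidual_coord (w : nat) (U : 'M[S]_(1, p * d)) : 'rV[L]_d :=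
  cblock (mx_coef U (w %/ p)) (inord (q - w %% p) : 'I_p).

Lemma bidual_coordE k (i : 'I_p) U :
  bidual_coord (p * k + (q - i)) U = cblock (mx_coef U k) i.
Proof.
have lt_p : (q - i < p)%N by rewrite ltnS leq_subr.
rewrite /bidual_coord [(p * k)%N]mulnC divnMDl // divn_small // addn0.
rewrite modnMDl modn_small // subKn; last by rewrite -ltnS.
by rewrite inord_val.
Qed.

(** Block i in degree k has position p k + (q - i). For i > 0 the identities in [dual_coef1] move it
    to block i - 1 in degree k + 1, a shift by p + 1 = n. Block 0 is moved by [dual_coef2] to the
    last block in degree k + 2, a shift by 2 p - q, which is again n. All other contributions come
    from blocks that vanish by hypothesis. *)
Lemma bidual_coord_lead w U :
  (forall w', (w < w')%N -> bidual_coord w' U = 0) ->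
  bidual_coord (w + n) (inn Phiv Psi U) =
  bidual_coord w U *m (if (w %% p < q)%N then 1%:M
     else frobm iota (w %/ p) (frobm iota 1 (invmx (mx_coef (Phi 'X) n)))^T).
Proof.
move=> U0.
have {}U0 k (i : 'I_p) : (w < p * k + (q - i))%N -> cblock (mx_coef U k) i = 0.
  by move/U0; rewrite bidual_coordE.
have [k [r [lt_rp ew]]] : exists k r, (r < p)%N /\ w = (p * k + r)%N.
  by exists (w %/ p)%N, (w %% p)%N; rewrite ltn_pmod // mulnC -divn_eq.
have lt_i0 : (q - r < p)%N by rewrite ltnS leq_subr.
pose i0 := Ordinal lt_i0.
have ri0 : r = (q - i0)%N by rewrite /= subKn // -ltnS.
have -> : bidual_coord w U = cblock (mx_coef U k) i0.
  by rewrite ew {1}ri0 bidual_coordE.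
have -> : (w %/ p = k)%N by rewrite ew mulnC divnMDl // divn_small ?addn0.
have -> : (w %% p = r)%N by rewrite ew mulnC modnMDl modn_small.
case: ltnP => [lt_rq|le_qr].
  have lt_i1 : (q - r.+1 < p)%N by rewrite ltnS leq_subr.
  pose i1 := Ordinal lt_i1.
  have ri1 : r.+1 = (q - i1)%N by rewrite /= subKn.
  have i01 : i0 = i1.+1 :> nat by rewrite /= -subSn // subSS.
  have -> : (w + n = p * k.+1 + (q - i1))%N.
    by rewrite -ri1 ew mulnS !addnS [(p + _)%N]addnC addnAC addnS.
  rewrite bidual_coordE mx_coef_inn_dual !cblockB.
  have Uk1 : cblock (mx_coef U k.+1) i1 = 0.
    apply: U0; rewrite -ri1 ew mulnS -addnA [(p + _)%N]addnC -addnA ltn_add2l.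
    by rewrite addSn ltnS addnC leq_addl.
  have Uk : cblock (mx_coef U k) i1 = 0.
    by apply: U0; rewrite -ri1 ew ltn_add2l.
  rewrite !cblockD cblock_mul_dual1 -frobm_cblock Uk frobm_mx0 cblockZ Uk1 scaler0.
  rewrite frobm_scalar mul_mx_scalar cblockZ Uk1 scaler0 add0r mulmx1 addr0 subr0.
  rewrite (bigD1 i0) ?i01 ?eqxx //= big1 ?addr0 => [|i /negPf ne_i]; last first.
    by rewrite -i01 -[_ == _ :> nat]/(i == i0) ne_i.
  have -> : (i1 == ord_max) = false.
    by apply/negbTE; rewrite -val_eqE /= neq_ltn subnS prednK ?subn_gt0 ?leq_subr.
  rewrite subr0; case: (k) => [|k']; last rewrite cblock_mul_dual2.
    by rewrite cblock0 addr0.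
  have -> : (i1 == ord_max) = false.
    by apply/negbTE; rewrite -val_eqE /= neq_ltn subnS prednK ?subn_gt0 ?leq_subr.
  by rewrite addr0.
have er : r = q by apply/eqP; rewrite eqn_leq le_qr -ltnS lt_rp.
have -> : i0 = ord0 by apply: val_inj; rewrite /= er subnn.
have Uk1 : mx_coef U k.+1 = 0.
  apply: cblockP => i; rewrite U0 ?ew ?cblock0 //.
  by rewrite mulnS er [(p + p * k)%N]addnC -addnA ltn_add2l addSn ltnS leq_addr.
have Uk2 : cblock (mx_coef U k.+2) ord_max = 0.
  apply: U0; rewrite ew er /= subnn addn0 !mulnS addnA [(p + p + _)%N]addnC.
  by rewrite ltn_add2l ltn_addr.
have -> : (w + n = p * k.+2 + (q - (ord_max : 'I_p)))%N.
  rewrite ew er /= subnn addn0 !mulnS addnA [(p + p + _)%N]addnC -[LHS]addnA.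
  by congr (_ + _)%N; rewrite addnS -addSn.
rewrite bidual_coordE mx_coef_inn_dual Uk1 mul0mx frobm_mx0 !addr0 frobm_scalar.
rewrite mul_mx_scalar cblockB cblockD !cblockZ Uk2 !scaler0 add0r subr0.
by rewrite cblock_mul_dual2 eqxx.
Qed.

Lemma bidual_coord_unit w : (if (w %% p < q)%N then 1%:M
     else frobm iota (w %/ p) (frobm iota 1 (invmx (mx_coef (Phi 'X) n)))^T) \in unitmx.
Proof.
case: ifP => _; first exact: unitmx1.
by rewrite frobm_unit // unitmx_tr frobm_unit // unitmx_inv.
Qed.

Lemma bidual_coordB w U V :
  bidual_coord w (U - V) = bidual_coord w U - bidual_coord w V.
Proof. by rewrite /bidual_coord mx_coefB cblockB. Qed.

Lemma bidual_coord_fin U :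
  exists N, forall w, (N <= w)%N -> bidual_coord w U = 0.
Proof.
exists (p * (mx_deg U).+1)%N => w le_w; rewrite /bidual_coord mx_coef_deg ?cblock0 //.
by rewrite leq_divRL // mulnC.
Qed.

Lemma bidual_coord_inj U : (forall w, bidual_coord w U = 0) -> U = 0.
Proof.
move=> U0; apply: mx_coefP => k; apply: cblockP => i.
by rewrite -bidual_coordE U0 mx_coef0 cblock0.
Qed.

Lemma bidual_coord_monomial w v : exists U,
  bidual_coord w U = v /\ forall w', (w < w')%N -> bidual_coord w' U = 0.
Proof.
pose i : 'I_p := inord (q - w %% p).
exists (mx_tw iota (w %/ p).+1 (fun k => if k == (w %/ p)%N
  then row_blocks (fun j => if j == i then v else 0) else 0)).
split=> [|w' lt_w]; rewrite /bidual_coord mx_coef_tw ltnS.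
  by rewrite leqnn eqxx cblock_row_blocks eqxx.
case: leqP => [le_w'|_]; last exact: cblock0.
have eq_w : (w' %/ p = w %/ p)%N by apply/eqP; rewrite eqn_leq le_w' leq_div2r // ltnW.
rewrite eq_w eqxx cblock_row_blocks ifF //; apply/negP => /eqP/(congr1 (@nat_of_ord _)).
have lt_mod x : (q - x %% p < p)%N by rewrite ltnS leq_subr.
rewrite /i !inordK // => /eqP.
have le_mod x : (x %% p <= q)%N by rewrite -ltnS ltn_pmod.
have lt_modw : (w %% p < w' %% p)%N.
  by move: lt_w; rewrite {1}(divn_eq w p) {1}(divn_eq w' p) eq_w ltn_add2l.
by rewrite ltn_eqF // ltn_sub2l // (leq_trans lt_modw).
Qed.

Lemma inn_bidual_inj U :
  (forall w, (n <= w)%N -> bidual_coord w (inn Phiv Psi U) = 0) -> U = 0.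
Proof.
exact: (@triangular_inj _ _ d n bidual_coord _ _ bidual_coord_fin bidual_coord_inj
  bidual_coord_lead bidual_coord_unit).
Qed.

Lemma inn_bidual_reduce D :
  exists U, forall w, (n <= w)%N -> bidual_coord w (D - inn Phiv Psi U) = 0.
Proof.
exact: (@triangular_surj _ _ d n bidual_coord _ _ bidual_coordB bidual_coord_fin
  bidual_coord_monomial (@innD _ _ _ _ _ _ _) bidual_coord_lead bidual_coord_unit).
Qed.

Lemma cblock_bidual_coef (z : 'cV[L]_d) j :
  cblock (z^T *m bidual_coef M) j =
  if j == ord_max then z^T *m (invmx (mx_coef (Phi 'X) n))^T else 0.
Proof. by rewrite cblock_mul cblock_row_blocks; case: ifP; rewrite ?mulmx0. Qed.

Lemma bidual_coord_rvec z w : (n <= w)%N ->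
  bidual_coord w (rvec (bidual_basis M) z) = 0.
Proof.
move=> le_nw; rewrite /bidual_coord mx_coef_bidual_rvec.
case: eqP => [div1|_]; last exact: cblock0.
rewrite cblock_bidual_coef ifF //; apply/negP => /eqP/(congr1 (@nat_of_ord _)).
rewrite /= inordK ?ltnS ?leq_subr // => /eqP.
have : (0 < w %% p)%N by move: le_nw; rewrite {1}(divn_eq w p) div1 mul1n -addn1 leq_add2l.
have : (w %% p <= q)%N by rewrite -ltnS ltn_pmod.
by case: (w %% p)%N => // m le_m _; rewrite ltn_eqF // subnS prednK ?subn_gt0 // leq_subr.
Qed.

(** The positions below n = p + 1 are the p blocks of the constant term and, at position p, the last
    block of degree 1. Only this one remains. *)
Lemma bidual_rvec_of_coord D : mx_coef D 0 = 0 ->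
  (forall w, (n <= w)%N -> bidual_coord w D = 0) ->
  D = rvec (bidual_basis M)
        (cblock (mx_coef D 1) ord_max *m (mx_coef (Phi 'X) n)^T)^T.
Proof.
move=> D0 Dbig; apply: mx_coefP => -[|[|k]]; rewrite mx_coef_bidual_rvec //=.
  apply: cblockP => j; rewrite cblock_bidual_coef trmxK; case: eqVneq => [->|ne_j].
    by rewrite -mulmxA -trmx_mul mulVmx // trmx1 mulmx1.
  rewrite -bidual_coordE Dbig // muln1 -addn1 leq_add2l subn_gt0.
  by rewrite ltn_neqAle -ltnS ltn_ord andbT -val_eqE in ne_j *.
apply: cblockP => j; rewrite -bidual_coordE Dbig ?cblock0 //.
rewrite !mulnS addnA -[X in (_ <= X)%N]addnA; apply: leq_trans (leq_addr _ _).
by rewrite addnS ltnS leq_addr.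
Qed.

(* Subtracting [inn Phiv Psi] of the constant row (u_0, ..., u_{p-1}) clears   *)
(* the terms that tau creates out of normal form, block after block.          *)
Definition bidual_corr (z : 'cV[L]_d) (x : 'cV[L]_(p * d)) (m : nat) : 'cV[L]_d :=
  frobm iota m.+1 z + \sum_(i < p | (i < m)%N) frobm iota (m - i) (rblock x i).

Lemma bidual_corr0 z x : bidual_corr z x 0 = frobm iota 1 z.
Proof. by rewrite /bidual_corr big_pred0 ?addr0. Qed.

Lemma bidual_corrS z x (j : 'I_p) :
  bidual_corr z x j.+1 = frobm iota 1 (bidual_corr z x j + rblock x j).
Proof.
rewrite /bidual_corr !frobmD frobm_add add1n -addrA; congr (_ + _).
rewrite (bigD1 j) ?ltnSn //= subSnn addrC; congr (_ + _).
rewrite frobm_sum; apply: eq_big => [i|i lt_ij].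
  by rewrite ltnS -(inj_eq val_inj) /= ltn_neqAle andbC.
by case/andP: lt_ij => lt_ij _; rewrite frobm_add add1n subSn.
Qed.

(** The part of [bidual_corr z x m] that comes from [z] is its twist by tau^(m+1), so these parts
    add up to the terms of positive degree of Phi_t; the parts from [x] give [bidual_ext_mx] by
    regrouping along i. *)
Lemma bidual_eval z x :
  mx_eval (Phi 'X) z + mx_eval (bidual_ext_mx M) x =
  theta *: z + \sum_(m < n) mx_coef (Phi 'X) m.+1 *m bidual_corr z x m.
Proof.
rewrite (@mx_evalE _ _ _ n.+1) => [|k /M_big //].
rewrite big_ord_recl frobm0 Phi0 mul_scalar_mx -addrA; congr (_ + _).
under [RHS]eq_bigr do rewrite mulmxDr.
rewrite big_split; congr (_ + _).
rewrite (@mx_evalE _ _ _ n) => [|k le_k]; last by rewrite mx_coef_tw ltnNge le_k.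
rewrite big_ord_recl mx_coef_tw mul0mx add0r.
under [LHS]eq_bigr => k _ do
  rewrite mx_coef_tw lift0 ltnS ltn_ord /= row_blocks_mul.
rewrite [LHS]exchange_big /=.
under [RHS]eq_bigr do rewrite mulmx_sumr big_mkcond.
rewrite [RHS]exchange_big; apply: eq_bigr => i _ /=; rewrite -big_mkcond /=.
pose g m := mx_coef (Phi 'X) m.+1 *m frobm iota (m - i) (rblock x i).
(* Here m = i + (k + 1), where k + 1 is the tau-degree. The range overshoots n, but there M_(m+1) =
   0. *)
transitivity (\sum_(i.+1 <= m < p + i.+1) g m).
  rewrite -[X in index_iota X]add0n big_addn addnK big_mkord.
  apply: eq_bigr => k _; rewrite /g -[(k + i.+1)%N]addSnnS addnK [(k.+1 + i)%N]addnC.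
  by rewrite frobm_rblock.
have le_in : (i.+1 <= n)%N by rewrite ltnS ltnW.
have le_np : (n <= p + i.+1)%N by rewrite addnS ltnS leq_addr.
have tail0 : \sum_(n <= m < p + i.+1) g m = 0.
  rewrite big_nat big1 // => m /andP[le_nm _].
  by rewrite /g M_big ?mul0mx.
rewrite (big_cat_nat le_in le_np) /= tail0 addr0.
by rewrite (@big_nat_widenl _ _ _ i.+1 0 n xpredT) // big_mkord.
Qed.

Lemma bidual_presents :
  presents Phiv Psi (bidual_basis M) (Phi 'X) (bidual_ext_mx M).
Proof.
have Phiv0 : no_nilpotence Phiv by rewrite /no_nilpotence PhivX mx_coef_tw.
split.
- exact: inn_const0.
- by move=> i; rewrite mx_coef_tw.
- move=> D D0; have [U DU0] := inn_bidual_reduce D.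
  have DU00 : mx_coef (D - inn Phiv Psi U) 0 = 0.
    by rewrite mx_coefB D0 (inn_const0 PsiX Phiv0) subrr.
  exists (cblock (mx_coef (D - inn Phiv Psi U) 1) ord_max *m (mx_coef (Phi 'X) n)^T)^T, U.
  by rewrite -(bidual_rvec_of_coord DU00 DU0) subrK.
- move=> z U ezU; have U0 : U = 0.
    by apply: inn_bidual_inj => w le_w; rewrite -ezU bidual_coord_rvec.
  have := cblock_bidual_coef z ord_max; rewrite eqxx.
  have := mx_coef_bidual_rvec M z 1; rewrite /= ezU U0 inn0 mx_coef0 => <-.
  move/(congr1 (fun v => (v *m (mx_coef (Phi 'X) n)^T)^T)).
  rewrite -mulmxA -trmx_mul mulmxV // trmx1 mulmx1 trmxK => <-.
  by rewrite cblock0 mul0mx trmx0.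
move=> z x; pose u := bidual_corr z x.
pose v : 'cV[L]_(p * d) := col_blocks (fun i : 'I_p => u i).
have cv i : cblock v^T i = (u i)^T.
  rewrite -(rblock_col_blocks (fun i : 'I_p => u i) i).
  by apply/matrixP=> a b; rewrite !mxE.
have cx i : cblock x^T i = (rblock x i)^T by apply/matrixP=> a b; rewrite !mxE.
exists (cst_row iota v); apply: mx_coefP => k.
rewrite (mx_coef_Carlitz_mul PsiX) !mx_coefD !mx_coef_cst_row !mx_coef_bidual_rvec.
case: k => [|k].
  by rewrite (inn_const0 PsiX Phiv0) /= !addr0 !add0r linearZ.
rewrite (mx_coef_inn_cst Phiv PsiX) PhivX mx_coef_tw /= !addr0.
rewrite mx_coefD mx_coef_cst_row mx_coef_bidual_rvec.
case: k => [|[|k]] /=; last by rewrite addr0 frobm_mx0 mulmx0 scaler0 subr0 !addr0.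
  (* In degree 1, the blocks before the last cancel by the recursion [bidual_corrS]; the last block
     produces the new coordinate [bidual_eval]. *)
  apply: cblockP => j; rewrite add0r -(frobm0 iota (dual_coef1 q M)).
  rewrite cblockD [RHS]cblockD cblockB cblockZ cblock_mul_dual1.
  rewrite !cblock_bidual_coef -!frobm_cblock cx cv; case: eqVneq => [ej|ne_j]; last first.
    have lt_jq : (j.+1 < p)%N by rewrite ltnS ltn_neqAle -ltnS ltn_ord andbT.
    rewrite scaler0 !add0r subr0 (bigD1 (Ordinal lt_jq)) //= eqxx cv /u bidual_corrS.
    rewrite big1 ?addr0 => [|i /negPf ne_i]; last first.
      by rewrite -[_ == _ :> nat]/(i == Ordinal lt_jq) ne_i.
    by rewrite frobmD linearD /= !frobm_tr addrAC subrr add0r.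
  rewrite ej big1 ?sub0r => [|i _]; last by rewrite ltn_eqF.
  rewrite bidual_eval linearD linearZ /= mulmxDl -scalemxAl -addrA.
  congr (_ + _).
  rewrite big_ord_recr /= linearD /= mulmxDl trmx_mul.
  have MnK (v' : 'rV[L]_d) :
      v' *m (mx_coef (Phi 'X) n)^T *m (invmx (mx_coef (Phi 'X) n))^T = v'.
    by rewrite -mulmxA -trmx_mul mulVmx // trmx1 mulmx1.
  rewrite MnK.
  have -> : (\sum_(i < p) mx_coef (Phi 'X) i.+1 *m bidual_corr z x i)^T
      *m (invmx (mx_coef (Phi 'X) n))^T
    = \sum_(i < p) cblock v^T i *m frobm iota 0
        (invmx (mx_coef (Phi 'X) n) *m mx_coef (Phi 'X) i.+1)^T.
    rewrite raddf_sum mulmx_suml; apply: eq_bigr => i _ /=.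
    by rewrite cv frobm0 !trmx_mul mulmxA.
  rewrite addrACA subrr add0r.
  by rewrite (bidual_corrS z x ord_max) frobmD linearD /= !frobm_tr addrAC subrr add0r.
(* In degree 2 only the last block is non-zero; it is cancelled through [dual_coef2] by u_0, the
   Frobenius twist of z. *)
rewrite scaler0 !add0r addr0 subr0; apply: cblockP => j.
rewrite -(frobm0 iota (dual_coef2 iota q M)) cblock_mul_dual2 -frobm_cblock.
rewrite cblock_bidual_coef; case: eqP => _; last by rewrite frobm_mx0.
by rewrite cv /u bidual_corr0 frobm0 frobmM !frobm_tr.
Qed.

End BidualPresentation.

Lemma presents_eq (F : finFieldType) (L : fieldType) (iota : {rmorphism {poly F} -> L})
    d m (Phi : tmodule iota d) (Psi : tmodule iota 1)
    (b b' : 'I_m -> 'M[twisted iota]_(1, d)) T B :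
  (forall i, b i = b' i) -> presents Phi Psi b T B -> presents Phi Psi b' T B.
Proof.
move=> eqb [in0 b0 surj inj act].
have eqr z : rvec b z = rvec b' z by exact: eq_rvec.
split=> // [i|D /surj[z [U ->]]|z U|z x].
- by rewrite -eqb.
- by exists z, U; rewrite eqr.
- by rewrite -eqr => /inj.
- by have [U eU] := act z x; exists U; rewrite -!eqr.
Qed.

(** * Base change of the explicit matrices *)

Section DualBaseChange.
Variables (F : finFieldType) (L : fieldType) (iota : {rmorphism {poly F} -> L}).
Variables (K : fieldType) (j : {rmorphism L -> K}) (d q : nat).
Local Notation bci := (bc_iota iota j).
Variables (M : nat -> 'M[L]_d) (M' : nat -> 'M[K]_d).
Hypothesis M'E : forall k, M' k = map_mx j (M k).

Lemma bc_mx_tw m r N (A : nat -> 'M[L]_(m, r)) (A' : nat -> 'M[K]_(m, r)) :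
  (forall k, A' k = map_mx j (A k)) -> bc_mx j (mx_tw iota N A) = mx_tw bci N A'.
Proof.
move=> A'E; apply: mx_coefP => k; rewrite mx_coef_bc !mx_coef_tw A'E.
by case: ifP => _; rewrite ?map_mx0.
Qed.

Lemma bc_dual_mx : bc_mx j (dual_mx iota q M) = dual_mx bci q M'.
Proof.
apply: bc_mx_tw => -[|[|k]]; first by rewrite map_scalar_mx.
  apply/matrixP=> a b; rewrite !mxE rmorphB /=; congr (_ - _).
    by case: ifP => _; rewrite !mxE ?rmorph0 ?rmorph_nat.
  case: ifP => _; last by rewrite !mxE rmorph0.
  by rewrite [LHS]mxE !M'E -map_invmx -map_mxM mxE [X in _ = j X]mxE.
apply/matrixP=> a b; rewrite !mxE.
case: ifP => _; last by rewrite !mxE rmorph0.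
by rewrite [LHS]mxE M'E -map_invmx frobm_bc mxE [X in _ = j X]mxE.
Qed.

Lemma bc_dual_ext_mx : bc_mx j (dual_ext_mx iota d q) = dual_ext_mx bci d q.
Proof.
apply: bc_mx_tw => k; case: eqP => _; last by rewrite map_mx0.
apply/matrixP=> a b; rewrite !mxE.
by case: (_ == ord0); rewrite !mxE ?rmorph0 // rmorph_nat.
Qed.

Lemma bc_bidual_basis k : bc_mx j (bidual_basis iota q M k) = bidual_basis bci q M' k.
Proof.
apply: bc_mx_tw => e; case: eqP => _; last by rewrite map_mx0.
rewrite map_row; congr (row k _); apply/matrixP=> a b; rewrite !mxE.
case: ifP => _; last by rewrite !mxE rmorph0.
by rewrite M'E -map_invmx mxE [LHS]mxE [X in _ = j X]mxE.
Qed.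

Lemma bc_bidual_ext_mx : bc_mx j (bidual_ext_mx iota q M) = bidual_ext_mx bci q M'.
Proof.
apply: bc_mx_tw => k; case: eqP => _; first by rewrite map_mx0.
by apply/matrixP=> a b; rewrite !mxE M'E !mxE.
Qed.

Lemma bc_CarlitzX :
  bc_tm j (Carlitz iota) 'X = (tcst bci (theta bci) + tau bci)%:M.
Proof.
rewrite bc_tmX.
have -> : Carlitz iota 'X = (tcst iota (theta iota) + tau iota)%:M by exact: tm_homX.
by rewrite /bc_mx map_scalar_mx rmorphD /= bc_tw_tcst bc_tw_tau.
Qed.

Lemma bc_no_nilpotence m (Phi : tmodule iota m) :
  no_nilpotence Phi -> no_nilpotence (bc_tm j Phi).
Proof.
by move=> Phi0; rewrite /no_nilpotence bc_tmX mx_coef_bc Phi0 map_scalar_mx.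
Qed.

Lemma bc_rvec e m (b : 'I_m -> 'M[twisted iota]_(e, d)) x :
  bc_mx j (rvec b x) = rvec (fun i => bc_mx j (b i)) (map_mx j x).
Proof.
rewrite /rvec /bc_mx raddf_sum; apply: eq_bigr => i _.
by rewrite [LHS]map_mxZ /= bc_tw_tcst mxE.
Qed.

Lemma bc_inn e (Phi : tmodule iota d) (Psi : tmodule iota e) U :
  bc_mx j (inn Phi Psi U) = inn (bc_tm j Phi) (bc_tm j Psi) (bc_mx j U).
Proof. by rewrite !inn.unlock !bc_tmX -!bc_mxM [LHS]map_mxB. Qed.

End DualBaseChange.

(** * The dual, the two extension modules and biduality *)

Section Duality.
Variables (F : finFieldType) (L : fieldType) (iota : {rmorphism {poly F} -> L}).
Local Notation S := (twisted iota).
Variables (d q : nat) (Phi : tmodule iota d).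
Local Notation p := q.+1.
Local Notation n := q.+2.
Local Notation C := (Carlitz iota).
Hypothesis Phi0 : no_nilpotence Phi.
Hypothesis Mn_unit : mx_coef (Phi 'X) n \in unitmx.
Hypothesis M_big : forall k, (n < k)%N -> mx_coef (Phi 'X) k = 0.
Local Notation M := (fun k => mx_coef (Phi 'X) k).

Lemma CarlitzX : C 'X = (tcst iota (theta iota) + tau iota)%:M.
Proof. exact: tm_homX. Qed.

Fact dual_nilp : exists k, (mx_coef (dual_mx iota q M) 0 - (theta iota)%:M) ^+ k = 0.
Proof. by exists 1%N; rewrite expr1 mx_coef_tw subrr. Qed.

Definition dual_tm : tmodule iota (p * d) := tmodule_of_mx dual_nilp.

Lemma dual_tmX : dual_tm 'X = dual_mx iota q M.
Proof. exact: tm_homX. Qed.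

Section OverField.
Variables (K : fieldType) (j : {rmorphism L -> K}).

Lemma mx_coef_bc_tm k : mx_coef (bc_tm j Phi 'X) k = map_mx j (mx_coef (Phi 'X) k).
Proof. by rewrite bc_tmX mx_coef_bc. Qed.

Lemma bc_lead_unit : mx_coef (bc_tm j Phi 'X) n \in unitmx.
Proof. by rewrite mx_coef_bc_tm map_unitmx. Qed.

Lemma bc_coef_big k : (n < k)%N -> mx_coef (bc_tm j Phi 'X) k = 0.
Proof. by move=> lt_nk; rewrite mx_coef_bc_tm M_big ?map_mx0. Qed.

Lemma bc_dual_presents :
  presents (bc_tm j Phi) (bc_tm j C) (fun i => bc_mx j (dual_basis iota n d i))
    (bc_mx j (dual_tm 'X)) (bc_mx j (dual_ext_mx iota d q)).
Proof.
rewrite dual_tmX (bc_dual_mx _ _ mx_coef_bc_tm) bc_dual_ext_mx.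
have := dual_presents (bc_CarlitzX iota j) (bc_no_nilpotence j Phi0) bc_lead_unit bc_coef_big.
by apply: presents_eq => i; rewrite bc_dual_basis.
Qed.

Lemma bc_bidual_presents :
  presents (bc_tm j dual_tm) (bc_tm j C) (fun i => bc_mx j (bidual_basis iota q M i))
    (bc_mx j (Phi 'X)) (bc_mx j (bidual_ext_mx iota q M)).
Proof.
rewrite -bc_tmX (bc_bidual_ext_mx _ _ mx_coef_bc_tm).
have bc_dualX : bc_tm j dual_tm 'X
    = dual_mx (bc_iota iota j) q (fun k => mx_coef (bc_tm j Phi 'X) k).
  by rewrite bc_tmX dual_tmX (bc_dual_mx _ _ mx_coef_bc_tm).
have := bidual_presents (bc_CarlitzX iota j) (bc_no_nilpotence j Phi0)
  bc_lead_unit bc_coef_big bc_dualX.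
by apply: presents_eq => i; rewrite (bc_bidual_basis _ _ mx_coef_bc_tm).
Qed.

End OverField.

Lemma dual_tm_Ext0 : Ext0_structure Phi C dual_tm (dual_basis iota n d).
Proof. exact: presents_Ext0 bc_dual_presents. Qed.

Lemma Ext_dual :
  exists (E : tmodule iota (p * d + d)) (bE : 'I_(p * d + d) -> 'M[S]_(1, d)),
    Ext_structure Phi C E bE /\
    exists f g, tm_short_exact dual_tm E (Ga iota d) f g /\
      is_Ext0_to_Ext Phi C (dual_basis iota n d) bE f.
Proof.
have T0 : no_nilpotence dual_tm by rewrite /no_nilpotence dual_tmX mx_coef_tw.
have B0 : mx_coef (dual_ext_mx iota d q) 0 = 0 by rewrite mx_coef_tw.
exists (ext_tm T0 B0), (ext_basis (dual_basis iota n d)); split.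
  exact: presents_Ext bc_dual_presents.
exists (col_mx 1%:M 0), (row_mx 0 1%:M).
by split; [exact: ext_exact | exact: ext_inclusion].
Qed.

Lemma Ext_bidual :
  exists (E : tmodule iota (d + p * d)) (bE : 'I_(d + p * d) -> 'M[S]_(1, p * d))
         (Phivv : tmodule iota d) (bvv : 'I_d -> 'M[S]_(1, p * d)) (eta : 'M[S]_d),
    [/\ Ext_structure dual_tm C E bE,
        Ext0_structure dual_tm C Phivv bvv,
        tm_iso Phi Phivv eta
      & exists f g, tm_short_exact Phi E (Ga iota (p * d)) f g /\
          exists2 h, is_Ext0_to_Ext dual_tm C bvv bE h & f = h *m eta].
Proof.
have B0 : mx_coef (bidual_ext_mx iota q M) 0 = 0 by rewrite mx_coef_tw.
exists (ext_tm Phi0 B0), (ext_basis (bidual_basis iota q M)).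
(* The presentation of the bidual has [Phi 'X] as the matrix of t, so the bidual is [Phi] and the
   isomorphism is the identity. *)
exists Phi, (bidual_basis iota q M), 1%:M.
split.
- exact: presents_Ext bc_bidual_presents.
- exact: presents_Ext0 bc_bidual_presents.
- have mor1 : tm_morphism Phi Phi 1%:M by rewrite /tm_morphism mul1mx mulmx1.
  by split=> //; exists 1%:M; rewrite mulmx1.
exists (col_mx 1%:M 0), (row_mx 0 1%:M); split; first exact: ext_exact.
by exists (col_mx 1%:M 0); [exact: ext_inclusion | rewrite mulmx1].
Qed.

End Duality.

(** * Dual morphisms *)

Section GenericPoint.
Variables (F : finFieldType) (L : fieldType) (iota : {rmorphism {poly F} -> L}).
Local Notation S := (twisted iota).

Definition to_ratfun : {rmorphism L -> {fraction {poly L}}} := @tofrac {poly L} \o polyC.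

(** At the indeterminate X the value is the polynomial with coefficient p_k at X^(q^k); the
    exponents are distinct since q > 1, so no terms merge. *)
Lemma tw_eval_generic_inj (p : S) :
  tw_eval (bc_tw to_ratfun p) (tofrac 'X) = 0 -> p = 0.
Proof.
have card_gt1 : (1 < #|F|)%N := finNzRing_gt1 F.
set N := skew_size p.
rewrite (@tw_evalE _ _ _ N) => [p0|]; last first.
  apply/leq_sizeP => k le_k; rewrite -/(skew_coef _ k) skew_coef_bc /skew_coef.
  by rewrite nth_default ?rmorph0.
pose P := \sum_(k < N) skew_coef p k *: ('X : {poly L}) ^+ (#|F| ^ k).
have P0 : P = 0.
  apply/eqP; rewrite -(tofrac_eq0 P) -[X in _ == X]p0 rmorph_sum.
  apply/eqP; apply: eq_bigr => k _.
  by rewrite skew_coef_bc frobiE -mul_polyC rmorphM rmorphXn.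
apply: skew_polyP => k; rewrite skew_coef0.
have [lt_kN|le_Nk] := ltnP k N; last by rewrite /skew_coef nth_default.
have /(congr1 (fun r : {poly L} => r`_(#|F| ^ k))) := P0.
rewrite coef0 coef_sum (bigD1 (Ordinal lt_kN)) //= coefZ coefXn eqxx mulr1.
rewrite big1 ?addr0 // => i ne_i; rewrite coefZ coefXn eqn_exp2l //.
by rewrite eq_sym -[_ == _]/(i == Ordinal lt_kN) (negPf ne_i) mulr0.
Qed.

(** Entries are separated by the points X e_l over L(X). Points over L would not suffice: on a
    finite L a power of tau acts as the identity. *)
Lemma mx_eval_inj m n (A B : 'M[S]_(m, n)) :
  (forall (K : fieldType) (j : {rmorphism L -> K}) x,
     mx_eval (bc_mx j A) x = mx_eval (bc_mx j B) x) -> A = B.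
Proof.
move=> eqAB; apply/eqP; rewrite -subr_eq0; apply/eqP/matrixP=> a l.
rewrite [RHS]mxE; apply: tw_eval_generic_inj.
have /colP/(_ a) := eqAB _ to_ratfun (tofrac 'X *: delta_mx l 0).
have evE (M : 'M[S]_(m, n)) :
    mx_eval (bc_mx to_ratfun M) (tofrac 'X *: delta_mx l 0) a 0
    = tw_eval (bc_tw to_ratfun (M a l)) (tofrac 'X).
  rewrite mxE (bigD1 l) //= !mxE !eqxx mulr1 big1 ?addr0 // => k /negPf ne_k.
  by rewrite !mxE ne_k mulr0 tw_eval0r.
rewrite !evE [(A - B) a l]mxE [X in A a l + X]mxE => eqABal.
apply: (addIr (tw_eval (bc_tw to_ratfun (B a l)) (tofrac 'X))).
by rewrite -tw_evalDl -rmorphD subrK eqABal add0r.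
Qed.

End GenericPoint.

Section Intertwining.
Variables (F : finFieldType) (L : fieldType) (iota : {rmorphism {poly F} -> L}).
Local Notation S := (twisted iota).
Variables (d e : nat) (Phi : tmodule iota d) (Psi : tmodule iota e).
Variable beta : 'M[S]_(e, d).
Hypothesis mor_beta : tm_morphism Phi Psi beta.

Lemma tm_morphism_all a : beta *m Phi a = Psi a *m beta.
Proof.
elim/poly_ind: a => [|a c IH]; first by rewrite !rmorph0 mulmx0 mul0mx.
rewrite !rmorphD !rmorphM /= !tm_alg mulmxDr mulmxDl; congr (_ + _).
  by rewrite -[_ * Phi 'X]/(_ *m _) -[_ * Psi 'X]/(_ *m _) mulmxA IH -!mulmxA mor_beta.
by rewrite -scalemx1 tcst_scale_mul mulmx1 mul_scalar_mx.
Qed.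

Lemma Der_mulr r (C : tmodule iota r) delta :
  Der Psi C delta -> Der Phi C (fun a => delta a *m beta).
Proof.
case=> lin leib; split=> [c a b|a b].
  by rewrite lin mulmxDl scalemxAl.
by rewrite leib mulmxDl !mulmxA -(mulmxA _ (Psi b)) -tm_morphism_all !mulmxA.
Qed.

Lemma inn_mulr r (C : tmodule iota r) U :
  inn Psi C U *m beta = inn Phi C (U *m beta).
Proof. by rewrite !inn.unlock mulmxBl -!mulmxA mor_beta. Qed.

End Intertwining.

Lemma bc_tm_morphism (F : finFieldType) (L : fieldType) (iota : {rmorphism {poly F} -> L})
    (K : fieldType) (j : {rmorphism L -> K}) d e (Phi : tmodule iota d)
    (Psi : tmodule iota e) beta :
  tm_morphism Phi Psi beta -> tm_morphism (bc_tm j Phi) (bc_tm j Psi) (bc_mx j beta).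
Proof.
by rewrite /tm_morphism => mor; rewrite !bc_tmX -!bc_mxM mor.
Qed.

(** * Reduction to normal form as a twisted matrix *)

Section Reduction.
Variables (F : finFieldType) (L : fieldType) (iota : {rmorphism {poly F} -> L}).
Local Notation S := (twisted iota).
Variables (d q : nat) (Phi : tmodule iota d).
Local Notation p := q.+1.
Local Notation n := q.+2.
Local Notation C := (Carlitz iota).
Hypothesis Phi0 : no_nilpotence Phi.
Hypothesis Mn_unit : mx_coef (Phi 'X) n \in unitmx.
Hypothesis M_big : forall k, (n < k)%N -> mx_coef (Phi 'X) k = 0.

(* tau (c U) = c^q tau U is not c tau U, so a multiple c D of a fixed row     *)
(* reduces to the value at c of a twisted polynomial.                         *)
Lemma reduce_row (D : 'M[S]_(1, d)) : mx_coef D 0 = 0 ->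
  exists R : 'M[S]_(p * d, 1), forall (K : fieldType) (j : {rmorphism L -> K}) (x : K),
  exists U, tcst _ x *: bc_mx j D =
    rvec (fun l => bc_mx j (dual_basis iota n d l)) (mx_eval (bc_mx j R) x%:M)
    + inn (bc_tm j Phi) (bc_tm j C) U.
Proof.
have [N DN] : exists N, forall k, (n + N <= k)%N -> mx_coef D k = 0.
  exists (mx_deg D).+1 => k le_k; apply: mx_coef_deg; apply: leq_trans le_k.
  exact: leq_addl.
elim: N D DN => [|N IH] D DN D0.
  pose y : 'cV[L]_(p * d) := col_blocks (fun i : 'I_p => (mx_coef D i.+1)^T).
  have eD : D = rvec (dual_basis iota n d) y.
    by apply: dual_rvec_of_coef => // k le_k; rewrite DN ?addn0.
  exists (map_mx (tcst iota) y) => K j x; exists 0; rewrite inn0 addr0.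
  rewrite {1}eD bc_rvec -rvecZ; congr rvec; apply/colP=> a.
  by rewrite !mxE big_ord1 !mxE bc_tw_tcst tw_eval_tcst mulrC.
(* As in [triangular_surj], [inn U0] has the same term of degree N + n as [D]. *)
have [U0 [U0N U0big]] := row_monomial iota N
  (mx_coef D (N + n) *m invmx (frobm iota N (mx_coef (Phi 'X) n))).
have CX := CarlitzX iota.
(* By [inn_tcstZ], x D is congruent to x D1 + x^q D2 modulo inner terms. Both rows have smaller
   degree than the bound for [D] (for [D2] because n >= 2), and x^q accounts for the factor tau
   after [R2] below. *)
pose D2 : 'M[S]_(1, d) := tau iota *: U0; pose D1 := D - inn Phi C U0 - D2.
have D20 : mx_coef D2 0 = 0 by rewrite mx_coef_tauZ.
have D10 : mx_coef D1 0 = 0 by rewrite !mx_coefB D0 D20 (inn_const0 CX Phi0) !subr0.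
have D2N k : (n + N <= k)%N -> mx_coef D2 k = 0.
  rewrite mx_coef_tauZ; case: k => // k le_k; rewrite U0big ?frobm_mx0 //.
  by rewrite -ltnS (leq_trans _ le_k) // addSn ltnS addSn ltnS leq_addl.
have D1N k : (n + N <= k)%N -> mx_coef D1 k = 0.
  move=> le_k; rewrite mx_coefB D2N // subr0 mx_coefB.
  have lead w : (N <= w)%N ->
      mx_coef (inn Phi C U0) (w + n) = mx_coef U0 w *m frobm iota w (mx_coef (Phi 'X) n).
    move=> le_w; apply: (mx_coef_inn_lead CX M_big) => w' lt_w.
    by apply: U0big; apply: leq_ltn_trans lt_w.
  move: le_k; rewrite leq_eqVlt => /predU1P[<-|lt_k].
    by rewrite addnC lead // U0N mulmxKV ?subrr // frobm_unit.
  have le_nk : (n <= k)%N by rewrite (leq_trans (leq_addr N n)) // ltnW.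
  have lt_Nk : (N < k - n)%N by rewrite ltn_subRL.
  rewrite DN ?addnS // sub0r -(subnK le_nk) lead; last exact: ltnW.
  by rewrite U0big // mul0mx oppr0.
have [R1 hR1] := IH D1 D1N D10; have [R2 hR2] := IH D2 D2N D20.
exists (R1 + R2 *m (tau iota)%:M) => K j x.
have [V1 eV1] := hR1 K j x; have [V2 eV2] := hR2 K j (frob (bc_iota iota j) x).
exists (V1 + V2 + tcst _ x *: bc_mx j U0).
have -> : D = D1 + D2 + inn Phi C U0 by rewrite /D1 subrK subrK.
have -> : mx_eval (bc_mx j (R1 + R2 *m (tau iota)%:M)) x%:M
  = mx_eval (bc_mx j R1) x%:M + mx_eval (bc_mx j R2) (frob (bc_iota iota j) x)%:M.
  rewrite /bc_mx map_mxD mx_evalDl map_mxM mx_evalM; congr (_ + mx_eval _ _).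
  apply/colP=> a; rewrite !ord1 !mxE big_ord1 !mxE !eqxx !mulr1n /= bc_tw_tau.
  by rewrite tw_eval_tau.
rewrite rvecD !innD (inn_tcstZ _ (bc_CarlitzX iota j)).
have bcD (A B : 'M[S]_(1, d)) : bc_mx j (A + B) = bc_mx j A + bc_mx j B.
  exact: map_mxD.
have bcD2 : bc_mx j D2 = tau (bc_iota iota j) *: bc_mx j U0.
  by rewrite /bc_mx map_mxZ /= bc_tw_tau.
rewrite (bcD (D1 + D2)) (bcD D1) bc_inn 2!scalerDr -bcD2 eV1 eV2.
have abel (V : zmodType) (r1 i1 r2 i2 t2 u : V) :
    r1 + i1 + t2 + u = r1 + r2 + (i1 + i2 + (u + (t2 - (r2 + i2)))).
  rewrite [RHS]addrA (addrACA r1 r2); move: (r1 + i1) (r2 + i2) => a s.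
  by rewrite -!addrA (addrCA s u) (addrCA s t2) subrr addr0 (addrC t2).
exact: abel.
Qed.

(** The row is a sum of multiples of the fixed rows b_l beta; [reduce_row] applied to each of them
    gives column l. *)
Lemma reduce_mulr e q' (Psi : tmodule iota e) (beta : 'M[S]_(e, d)) :
  exists betav : 'M[S]_(p * d, q'.-1 * e),
  forall (K : fieldType) (j : {rmorphism L -> K}) (x : 'cV[K]_(q'.-1 * e)),
  exists U, rvec (fun l => bc_mx j (dual_basis iota q' e l)) x *m bc_mx j beta =
    rvec (fun l => bc_mx j (dual_basis iota n d l)) (mx_eval (bc_mx j betav) x)
    + inn (bc_tm j Phi) (bc_tm j C) U.
Proof.
have D0 l : mx_coef (dual_basis iota q' e l *m beta) 0 = 0.
  by rewrite mx_coefM big_ord1 dual_basis_coef0 mul0mx.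
have [R hR] := fin_all_exists (fun l => reduce_row (D0 l)).
exists (\matrix_(a, l) R l a 0) => K j x.
have [U eU] := fin_all_exists (fun l => hR l K j (x l 0)).
exists (\sum_l U l); rewrite /rvec mulmx_suml.
transitivity (\sum_l (rvec (fun l => bc_mx j (dual_basis iota n d l))
    (mx_eval (bc_mx j (R l)) (x l 0)%:M) + inn (bc_tm j Phi) (bc_tm j C) (U l))).
  by apply: eq_bigr => l _; rewrite -eU bc_mxM scalemxAl.
rewrite big_split /=; congr (_ + _); last first.
  elim/big_rec2: _ => [|l V W _ ->]; first by rewrite inn0.
  by rewrite innD.
transitivity (rvec (fun l => bc_mx j (dual_basis iota n d l))
    (\sum_l mx_eval (bc_mx j (R l)) (x l 0)%:M)).
  elim/big_rec2: _ => [|l V W _ ->]; last by rewrite rvecD.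
  by rewrite rvec0.
congr rvec; apply/colP=> a; rewrite summxE [RHS]mxE; apply: eq_bigr => l _.
by rewrite !mxE big_ord1 !mxE eqxx mulr1n.
Qed.

End Reduction.

Section DualMorphism.
Variables (F : finFieldType) (L : fieldType) (iota : {rmorphism {poly F} -> L}).
Local Notation S := (twisted iota).
Local Notation C := (Carlitz iota).
Variables (d e q r : nat) (Phi : tmodule iota d) (Psi : tmodule iota e).
Variables (Phiv : tmodule iota (q.+1 * d)) (Psiv : tmodule iota (r.-1 * e)).
Variable beta : 'M[S]_(e, d).
Hypothesis Phi0 : no_nilpotence Phi.
Hypothesis Mn_unit : mx_coef (Phi 'X) q.+2 \in unitmx.
Hypothesis M_big : forall k, (q.+2 < k)%N -> mx_coef (Phi 'X) k = 0.
Hypothesis dualPhi : Ext0_structure Phi C Phiv (dual_basis iota q.+2 d).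
Hypothesis dualPsi : Ext0_structure Psi C Psiv (dual_basis iota r e).
Hypothesis mor_beta : tm_morphism Phi Psi beta.

(** The duals in (c) are arbitrary t-modules known only through [Ext0_structure], so uniqueness of
    normal forms is extracted from that property. *)
Lemma Ext0_structure_inj m k (Theta : tmodule iota k) (Thetav : tmodule iota m)
    (b : 'I_m -> 'M[S]_(1, k)) (K : fieldType) (j : {rmorphism L -> K}) x y U :
  Ext0_structure Theta C Thetav b ->
  rvec (fun i => bc_mx j (b i)) x = rvec (fun i => bc_mx j (b i)) y
    + inn (bc_tm j Theta) (bc_tm j C) U -> x = y.
Proof.
move=> dualT exy; have [num _ inj _] := dualT K j; apply: inj.
have [[_ x0] [_ y0]] := (num x, num y).
rewrite /const0 in x0 y0; split; last first.
  rewrite /const0 [(_ \- _) _]/=.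
  rewrite mx_coefB.
  by rewrite [X in X - _]x0 [X in _ - X]y0 subrr.
apply/(Der_inP (DerB (rep_Der _ _ _ _) (rep_Der _ _ _ _))); exists U.
by rewrite /= !repX exy addrC addrA addNr add0r.
Qed.

Lemma Ext0_structure_act m k (Theta : tmodule iota k) (Thetav : tmodule iota m)
    (b : 'I_m -> 'M[S]_(1, k)) (K : fieldType) (j : {rmorphism L -> K}) x :
  Ext0_structure Theta C Thetav b ->
  exists U, bc_tm j C 'X *m rvec (fun i => bc_mx j (b i)) x =
    rvec (fun i => bc_mx j (b i)) (mx_eval (bc_mx j (Thetav 'X)) x)
    + inn (bc_tm j Theta) (bc_tm j C) U.
Proof.
move=> dualT; have [_ _ _ act] := dualT K j.
have [+ _] := act 'X x.
move/(Der_inP (DerB (Der_mull 'X (rep_Der _ _ _ _)) (rep_Der _ _ _ _)))=> [U eU].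
pose repK := rep (bc_tm j Theta) (bc_tm j C) (fun i => bc_mx j (b i)).
exists U; have {eU} : bc_tm j C 'X *m repK x 'X
    - repK (mx_eval (bc_tm j Thetav 'X) x) 'X
  = inn (bc_tm j Theta) (bc_tm j C) U by exact: eU.
by rewrite /repK !repX (bc_tmX j Thetav) => <-; rewrite [RHS]addrC subrK.
Qed.

(** Applying t before or after beta^v gives two normal forms of the one class of C_t x beta, over
    every K; they coincide, and [mx_eval_inj] makes this an identity of twisted matrices. *)
Lemma dual_morphism : exists betav : 'M[S]_(q.+1 * d, r.-1 * e),
  tm_morphism Psiv Phiv betav /\
  forall (K : fieldType) (j : {rmorphism L -> K}) (x : 'cV[K]_(r.-1 * e)),
    Der0_in (bc_tm j Phi) (bc_tm j C)
      ((fun a => rep_over Psi C j (dual_basis iota r e) x a *m bc_mx j beta)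
       \- rep_over Phi C j (dual_basis iota q.+2 d) (mx_eval (bc_mx j betav) x)).
Proof.
have [betav hb] := reduce_mulr Phi0 Mn_unit M_big r Psi beta.
exists betav; split=> [|K j x].
  apply: mx_eval_inj => K j x; rewrite !bc_mxM !mx_evalM.
  have morK := bc_tm_morphism j mor_beta.
  have [U eU] := Ext0_structure_act j x dualPsi.
  have [V eV] := hb K j (mx_eval (bc_mx j (Psiv 'X)) x).
  have [W eW] := hb K j x.
  have [Z eZ] := Ext0_structure_act j (mx_eval (bc_mx j betav) x) dualPhi.
  (* The inner errors of the two reductions: [U] and [V] arise when t acts first, [W] and [Z] when
     beta does. *)
  apply: (Ext0_structure_inj (U := Z + bc_tm j C 'X *m W - U *m bc_mx j beta - V) dualPhi).
  have := erefl (bc_tm j C 'X *m rvec (fun l => bc_mx j (dual_basis iota r e l)) x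
                   *m bc_mx j beta).
  rewrite {1}eU mulmxDl eV (inn_mulr morK) -mulmxA eW mulmxDr eZ inn_mul => eUb.
  rewrite !innB innD !addrA -eUb.
  by rewrite addrK addrK.
have morK := bc_tm_morphism j mor_beta.
have [U eU] := hb K j x.
have {}eU : rep_over Psi C j (dual_basis iota r e) x 'X *m bc_mx j beta
    - rep_over Phi C j (dual_basis iota q.+2 d) (mx_eval (bc_mx j betav) x) 'X
  = inn (bc_tm j Phi) (bc_tm j C) U.
  by rewrite /rep_over !repX eU addrC addrA addNr add0r.
split; last first.
  rewrite /const0 [(_ \- _) _]/= eU.
  exact: inn_const0 (bc_CarlitzX iota j) (bc_no_nilpotence j Phi0) U.
apply/(Der_inP (DerB (Der_mulr morK (rep_Der _ _ _ _)) (rep_Der _ _ _ _))).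
by exists U.
Qed.

End DualMorphism.

Theorem theorem1p3 (F : finFieldType) (L : fieldType)
    (iota : {rmorphism {poly F} -> L}) :
  (forall (d : nat) (Phi : tmodule iota d),
     strictly_pure Phi -> no_nilpotence Phi -> (2 <= tm_deg Phi)%N ->
     exists Phiv : tmodule iota ((tm_deg Phi).-1 * d),
     [/\ is_dual Phi Phiv,
         (* (a) *)
         exists (E : tmodule iota (tm_deg Phi * d))
                (bE : 'I_(tm_deg Phi * d) -> 'M[twisted iota]_(1, d)),
           Ext_structure Phi (Carlitz iota) E bE /\
           exists f g,
             tm_short_exact Phiv E (Ga iota d) f g /\
             is_Ext0_to_Ext Phi (Carlitz iota)
               (dual_basis iota (tm_deg Phi) d) bE f
       & (* (b) *)
         exists (E : tmodule iota (d * tm_deg Phi))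
                (bE : 'I_(d * tm_deg Phi) ->
                      'M[twisted iota]_(1, (tm_deg Phi).-1 * d))
                (Phivv : tmodule iota d)
                (bvv : 'I_d -> 'M[twisted iota]_(1, (tm_deg Phi).-1 * d))
                (eta : 'M[twisted iota]_d),
           [/\ Ext_structure Phiv (Carlitz iota) E bE,
               Ext0_structure Phiv (Carlitz iota) Phivv bvv,
               tm_iso Phi Phivv eta
             & exists f g,
                 tm_short_exact Phi E (Ga iota ((tm_deg Phi).-1 * d)) f g /\
                 exists2 h, is_Ext0_to_Ext Phiv (Carlitz iota) bvv bE h
                          & f = h *m eta]]) /\
  (* (c) *)
  (forall (d e : nat) (Phi : tmodule iota d) (Psi : tmodule iota e)
     (Phiv : tmodule iota ((tm_deg Phi).-1 * d))
     (Psiv : tmodule iota ((tm_deg Psi).-1 * e)) (beta : 'M[twisted iota]_(e, d)),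
     strictly_pure Phi -> no_nilpotence Phi -> (2 <= tm_deg Phi)%N ->
     strictly_pure Psi -> no_nilpotence Psi -> (2 <= tm_deg Psi)%N ->
     is_dual Phi Phiv -> is_dual Psi Psiv ->
     tm_morphism Phi Psi beta ->
     exists betav, tm_morphism Psiv Phiv betav /\ is_dual_map Phi Psi beta betav).
Proof.
have degE (d : nat) (Phi : tmodule iota d) : (2 <= tm_deg Phi)%N ->
    strictly_pure Phi -> exists2 q, tm_deg Phi = q.+2 &
    mx_coef (Phi 'X) q.+2 \in unitmx /\
    forall k, (q.+2 < k)%N -> mx_coef (Phi 'X) k = 0.
  move=> deg2 pure; exists (tm_deg Phi).-2; first by case: tm_deg deg2 => [|[]].
  have -> : (tm_deg Phi).-2.+2 = tm_deg Phi by case: tm_deg deg2 => [|[]].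
  by split=> // k; apply: mx_coef_deg.
split=> [d Phi pure nonil deg2|d e Phi Psi Phiv Psiv beta pure nonil deg2 _ _ _].
  have [q eq_q [unitM bigM]] := degE d Phi deg2 pure.
  (* The degree occurs in the dimensions, hence in types; it is generalized before being replaced by
     q + 2. *)
  rewrite /is_dual; move: (tm_deg Phi) eq_q => _ ->.
  exists (dual_tm q Phi); split; first exact: dual_tm_Ext0.
    (* The dimension n d is split as (n - 1) d + d, and below as d + (n - 1) d: in both cases the
       Ext^1_0 coordinates come first, then those of the additive quotient. *)
    by rewrite mulSn addnC; apply: Ext_dual.
  by rewrite mulnC mulSn; apply: Ext_bidual.
have [q eq_q [unitM bigM]] := degE d Phi deg2 pure.
rewrite /is_dual /is_dual_map; move: (tm_deg Phi) eq_q Phiv => _ -> Phiv.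
exact: dual_morphism.
Qed.
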